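(* Let $C\ge1$ and set $C'=\frac12(C+C^{-1})$. Let $\mathcal{H}$ be a Hilbert space, $T\in\mathcal{B}(\mathcal{H})$, and let $K\subset\mathbb{C}$ be compact. Then $K$ is a complete $C$-spectral set for $T$ if and only if $K$ is a complete $C'$-numerical radius set for $T$.
   Context: Hilbert spaces are complex and nonzero, and $\mathcal{B}(\mathcal{H})$ is the algebra of bounded operators on $\mathcal{H}$. The numerical radius of an operator $X$ is $w(X)=\sup\{|\langle Xx,x\rangle| : \|x\|=1\}$. Let $K\subset\mathbb{C}$ be compact. Implicit in both notions below is that $\sigma(T)\subset K$, so that $f(T)$ is defined for every rational function $f$ with poles off $K$. $R(K)$ denotes the uniform closure in $\mathrm{C}(K)$ of the rational functions with poles off $K$. For an $n\times n$ matrix $F=(f_{ij})$ of such functions, set $F(T)=(f_{ij}(T))\in\mathcal{M}_n(\mathcal{B}(\mathcal{H}))\simeq\mathcal{B}(\mathcal{H}^{(n)})$ and $\|F\|_K=\sup\{\|F(z)\| : z\in K\}$, with the operator norm on $M_n(\mathbb{C})$. $K$ is a complete $C$-spectral set for $T$ if $\|F(T)\|\le C\|F\|_K$ for all $n\ge1$ and all $n\times n$ matrices $F$ of rational functions with poles off $K$. This inequality then extends by continuity to matrices over $R(K)$. $K$ is a complete $C'$-numerical radius set for $T$ if $w(F(T))\le C'\|F\|_K$ for all $n\ge1$ and all $n\times n$ matrices $F$ over $R(K)$; here $f(T)$ for $f\in R(K)$ is the extension by continuity of the rational functional calculus, so equivalently it suffices to have the inequality for all $n\times n$ matrices $F$ of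 rational functions with poles off $K$. *)

(* Defs.v *)
From mathcomp Require Import all_boot all_order all_algebra.
From mathcomp Require Import all_classical all_reals all_analysis.
From mathcomp Require Import fraction sesquilinear complex.

Set Implicit Arguments.
Unset Strict Implicit.
Unset Printing Implicit Defensive.

Import Order.TTheory GRing.Theory Num.Theory numFieldNormedType.Exports.

Local Open Scope classical_set_scope.
Local Open Scope ring_scope.

(* [R[i]] packed as a numClosedFieldType, which is what makes the topology of
   numFieldNormedType available on it. *)
Definition Cplx (R : realType) : numClosedFieldType := R[i].

Definition modulus (R : realType) (z : Cplx R) : R := complex.Re `|z|.

Section FormNorms.
Context {R : realType} {V : lmodType (Cplx R)} (dot : V -> V -> Cplx R).

Definition form_norm (x : V) : R := Num.sqrt (complex.Re (dot x x)).

(* [sup] is the supremum in R, equal to 0 on sets that are empty or unbounded;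
   [op_norm] and [num_radius] are only meaningful for bounded X. *)
Definition op_norm (X : V -> V) : R :=
  sup [set form_norm (X x) | x in [set x | form_norm x <= 1]].

Definition num_radius (X : V -> V) : R :=
  sup [set modulus (dot (X x) x) | x in [set x | form_norm x = 1]].

(* The inner product of the Hilbert direct sum of n copies of V. *)
Definition dsum_dot (n : nat) (x y : {ffun 'I_n -> V}) : Cplx R :=
  \sum_i dot (x i) (y i).

Definition mx_op (n : nat) (A : 'M[V -> V]_n) (x : {ffun 'I_n -> V}) :
    {ffun 'I_n -> V} :=
  [ffun i => \sum_j A i j (x j)].

End FormNorms.

Section MatrixFunctions.
Context {R : realType}.
Local Notation C := (Cplx R).

Definition Cdot (z w : C^o) : C := z * Num.conj w.

(* The norm of a complex matrix as an operator on the Euclidean space C^n. *)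
Definition mx_norm2 (n : nat) (A : 'M[C]_n) : R :=
  op_norm (dsum_dot Cdot (n := n))
    (mx_op (map_mx (fun (a : C) (z : C^o) => (a * z : C^o)) A)).

Definition sup_norm (K : set C) (n : nat) (F : 'M[C -> C]_n) : R :=
  sup [set mx_norm2 (map_mx (fun f : C -> C => f z) F) | z in K].

(* A rational function is given by a fraction p / q with q != 0.  It has its
   poles off K iff some such fraction, e.g. the reduced one, has a denominator
   without zeros in K; only fractions of the latter kind are considered. *)
Definition poles_off (K : set C) (r : {ratio {poly C}}) : Prop :=
  forall z, K z -> (frac r).2.[z] != 0.

Definition rat_eval (r : {ratio {poly C}}) (z : C) : C :=
  (frac r).1.[z] / (frac r).2.[z].

Definition RK (K : set C) : set (C -> C) :=
  [set f | {within K, continuous f}] `&`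
  closure ([set rat_eval r | r in poles_off K] : set {uniform` K -> C}).

End MatrixFunctions.

Section Operators.
Context {R : realType} {H : completeNormedModType (Cplx R)}.
Local Notation C := (Cplx R).

Definition bounded_op (X : H -> H) : Prop :=
  linear X /\ exists M : C, forall x, `|X x| <= M * `|x|.

Definition spectrum (T : H -> H) : set C :=
  [set z | ~ exists S : H -> H, [/\ bounded_op S,
     cancel (fun x => T x - z *: x) S & cancel S (fun x => T x - z *: x)]].

Definition poly_op (T : H -> H) (p : {poly C}) (x : H) : H :=
  \sum_(i < size p) p`_i *: iter i T x.

(* p(T) q(T)^-1; [pinv setT] is the inverse whenever q(T) is bijective, which
   is the case if q has no zeros in the spectrum of T. *)
Definition rat_op (T : H -> H) (r : {ratio {poly C}}) : H -> H :=
  poly_op T (frac r).1 \o pinv setT (poly_op T (frac r).2).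

Variable dot : H -> H -> C.

(* X = f(T) for the extension by continuity of the rational functional
   calculus: X is the norm limit of r(T) as the rational function r, with poles
   off K, tends to f uniformly on K. *)
Definition RK_calculus (K : set C) (T : H -> H) (f : C -> C) (X : H -> H) :
    Prop :=
  bounded_op X /\
  forall e : R, 0 < e -> exists2 delta : R, 0 < delta &
    forall r, poles_off K r ->
      (forall z, K z -> modulus (rat_eval r z - f z) <= delta) ->
      op_norm dot (fun x => rat_op T r x - X x) <= e.

Definition complete_spectral_set (c : R) (K : set C) (T : H -> H) : Prop :=
  spectrum T `<=` K /\
  forall (n : nat) (F : 'M[{ratio {poly C}}]_n), (0 < n)%N ->
    (forall i j, poles_off K (F i j)) ->
    op_norm (dsum_dot dot (n := n)) (mx_op (map_mx (rat_op T) F))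
      <= c * sup_norm K (map_mx rat_eval F).

(* The existence of [X], which is then unique, expresses that F(T) is defined,
   i.e. that the rational functional calculus extends by continuity. *)
Definition complete_num_radius_set (c : R) (K : set C) (T : H -> H) : Prop :=
  spectrum T `<=` K /\
  forall (n : nat) (F : 'M[C -> C]_n), (0 < n)%N ->
    (forall i j, RK K (F i j)) ->
    exists2 X : 'M[H -> H]_n, (forall i j, RK_calculus K T (F i j) (X i j)) &
      num_radius (dsum_dot dot (n := n)) (mx_op X) <= c * sup_norm K F.

End Operators.

(* Main.v *)
Require Import Defs.
From HB Require Import structures.
From mathcomp Require Import all_boot all_order all_algebra.
From mathcomp Require Import all_classical all_reals all_analysis.
From mathcomp Require Import fraction sesquilinear complex ring lra.

Import Order.TTheory GRing.Theory Num.Theory numFieldNormedType.Exports.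

Local Open Scope classical_set_scope.
Local Open Scope ring_scope.

(** Let [F] be a matrix of rational functions with sup norm at most 1 on [K],
let [A = F(T)] and [r = 1/C].  Both implications are instances of a single
trick: apply the hypothesis to a contractive matrix function built from [F]
for which the resulting inequality is sharp.

Suppose that [K] is a complete [C]-spectral set, with [C > 1].  The Moebius
transform [G = (F - r)(1 - rF)^-1] is again contractive on [K], and
[G(T) (1 - rA) = A - r], so that [|(A - r)x| <= C |(1 - rA)x|].  For a unit
vector [x] and [t = Re <Ax, x>], squaring this gives
[|Ax|^2 - 2rt + r^2 <= C^2 - 2 C^2 r t + C^2 r^2 |Ax|^2].  As [Cr = 1], the
two terms in [|Ax|^2] cancel and what is left is [2t(C - r) <= C^2 - r^2],
that is [t <= (C + 1/C)/2].  Multiplying [F] by a unimodular constant replaces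
[Re <Ax, x>] by [|<Ax, x>|].  If [C = 1], Cauchy-Schwarz is enough.
([mobius_numerical_range_le], [mobius_mx_le1], [mobius_mx_op].)

Conversely, let [K] be a complete [C']-numerical radius set and let [v] be a
unit vector with [y = |Av| > C].  For [0 <= a <= 1] the block matrix
[[a, (1 - a^2)F], [0, a]] is contractive, and the quadratic form of its value
at [T] on the unit vector [(Av/y, v)/sqrt 2] is [a + (1 - a^2)y/2].  This is
largest for [a = 1/y], where it equals [(y + 1/y)/2].  Hence
[y + 1/y <= C + 1/C], which is absurd since [s + 1/s] increases on [s >= 1].
([block_contr], [num_radius_unit_le].)

The rest makes these computations legitimate.  A polynomial without zeros in
[K] is invertible at [T] because it splits into linear factors, whose zeros
are in the resolvent set.  Identities between rational functions of [T] are
proved after clearing denominators, with polynomial matrices acting on direct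
sums.  A uniform limit on [K] of rational functions is transported to [T]
because the spectral set inequality makes the values at [T] a Cauchy
sequence, and the numerical radius bound passes to the limit. *)

Set Implicit Arguments.
Unset Strict Implicit.
Unset Printing Implicit Defensive.

(** * The modulus of a complex number *)

Section Modulus.
Context {R : realType}.
Local Notation C := (Cplx R).
Implicit Types z w : C.

(** The constant [a%:C], with the type of the scalars of the vector spaces below. *)
Definition toC (a : R) : C := (a%:C)%C.

Lemma toCD a b : toC (a + b) = toC a + toC b.
Proof. exact: (rmorphD (real_complex R)). Qed.
Lemma toCM a b : toC (a * b) = toC a * toC b.
Proof. exact: (rmorphM (real_complex R)). Qed.
Lemma toC0 : toC 0 = 0. Proof. by []. Qed.
Lemma toC1 : toC 1 = 1. Proof. by []. Qed.
Lemma toCN a : toC (- a) = - toC a.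
Proof. exact: (rmorphN (real_complex R)). Qed.
Lemma toCX a n : toC (a ^+ n) = toC a ^+ n.
Proof. exact: (rmorphXn (real_complex R)). Qed.

Lemma toC_inj : injective toC. Proof. exact: complexI. Qed.
Lemma toC_le a b : (toC a <= toC b) = (a <= b). Proof. exact: lecR. Qed.

Lemma ReD z w : complex.Re (z + w) = complex.Re z + complex.Re w.
Proof. by case: z => a b; case: w. Qed.
Lemma ReZ a z : complex.Re (toC a * z) = a * complex.Re z.
Proof. by case: z => b d; rewrite /toC; simpc. Qed.
Lemma Re_conj z : complex.Re (Num.conj z) = complex.Re z.
Proof. by case: z. Qed.

Lemma normC_modulus z : `|z| = toC (modulus z).
Proof. by rewrite /modulus normc_def. Qed.

Lemma modulus_ge0 z : 0 <= modulus z.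
Proof. by rewrite /modulus normc_def sqrtr_ge0. Qed.

Lemma modulusM z w : modulus (z * w) = modulus z * modulus w.
Proof. by apply: toC_inj; rewrite toCM -!normC_modulus normrM. Qed.

Lemma modulusD z w : modulus (z + w) <= modulus z + modulus w.
Proof.
by rewrite -toC_le toCD -!normC_modulus ler_normD.
Qed.

Lemma modulus_toC a : modulus (toC a) = `|a|.
Proof. by rewrite /modulus normc_def /= expr0n /= addr0 sqrtr_sqr. Qed.

Lemma modulus0 : modulus (0 : C) = 0.
Proof. by rewrite -toC0 modulus_toC normr0. Qed.

Lemma modulusN z : modulus (- z) = modulus z.
Proof. by rewrite -mulN1r modulusM -toC1 -toCN modulus_toC normrN1 mul1r. Qed.

Lemma modulus_eq0 z : (modulus z == 0) = (z == 0).
Proof. by rewrite -(inj_eq toC_inj) -normC_modulus normr_eq0. Qed.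

Lemma modulusV z : modulus z^-1 = (modulus z)^-1.
Proof.
have [->|z0] := eqVneq z 0; first by rewrite invr0 modulus0 invr0.
have m0 : modulus z != 0 by rewrite modulus_eq0.
by apply: (mulfI m0); rewrite -modulusM !divff // -toC1 modulus_toC normr1.
Qed.

(** Rotations reduce statements on [|<x, y>|] to statements on [Re <x, y>]. *)
Lemma exists_phase z : exists2 u : C, modulus u = 1 & u * z = toC (modulus z).
Proof.
have [->|z0] := eqVneq z 0.
  by exists 1; rewrite ?mulr0 ?modulus0 // -toC1 modulus_toC normr1.
exists (toC (modulus z) / z); last by rewrite divfK.
by rewrite modulusM modulusV modulus_toC ger0_norm ?modulus_ge0 // divff ?modulus_eq0.
Qed.

Lemma conj_toC (a : R) : Num.conj (toC a) = toC a.
Proof. by rewrite /toC; exact: conjc_real. Qed.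

End Modulus.

(** * Inner product spaces *)

Section InnerProduct.
Context {R : realType} {V : lmodType (Cplx R)} (dot : {dot V for @Num.conj (Cplx R)}).
Local Notation C := (Cplx R).
Local Notation N := (form_norm dot).
Implicit Types x y : V.

Lemma form_norm_ge0 x : 0 <= N x. Proof. exact: sqrtr_ge0. Qed.

Lemma dotE x : dot x x = toC (N x ^+ 2).
Proof.
have h := dnorm_ge0 dot x.
have hi := ger0_Im h.
have hr : 0 <= complex.Re (dot x x) by move: h; rewrite lecE => /andP[].
by rewrite /form_norm sqr_sqrtr // /toC -[LHS]RRe_real // ger0_real.
Qed.

Lemma Re_dotE x : complex.Re (dot x x) = N x ^+ 2.
Proof. by rewrite dotE. Qed.

Lemma form_norm_eq0 x : (N x == 0) = (x == 0).
Proof.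
by rewrite -(dnorm_eq0 dot) dotE -toC0 (inj_eq (@toC_inj R)) sqrf_eq0.
Qed.

Lemma form_norm0 : N 0 = 0. Proof. by apply/eqP; rewrite form_norm_eq0. Qed.

Lemma dotC x y : dot x y = Num.conj (dot y x).
Proof. by rewrite hermC expr0 mul1r. Qed.

Lemma form_normZ a x : N (a *: x) = modulus a * N x.
Proof.
apply/eqP; rewrite -(@eqrXn2 _ 2) ?mulr_ge0 ?modulus_ge0 ?form_norm_ge0 //.
rewrite -(inj_eq (@toC_inj R)) -dotE dnormZ normC_modulus dotE.
by rewrite exprMn -toCX -toCM.
Qed.

Lemma form_normN x : N (- x) = N x.
Proof. by rewrite -scaleN1r form_normZ -toC1 -toCN modulus_toC normrN1 mul1r. Qed.

Lemma form_normD2 x y :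
  N (x + y) ^+ 2 = N x ^+ 2 + N y ^+ 2 + 2 * complex.Re (dot x y).
Proof.
by rewrite -!Re_dotE dnormD !ReD Re_conj mulr2n mulrDl !mul1r.
Qed.

Lemma Re_dotZ (a : R) x y : complex.Re (dot (toC a *: x) y) = a * complex.Re (dot x y).
Proof. by rewrite linearZl_LR ReZ. Qed.

Lemma Re_dotZr (a : R) x y : complex.Re (dot x (toC a *: y)) = a * complex.Re (dot x y).
Proof. by rewrite dotC Re_conj Re_dotZ dotC Re_conj. Qed.

(** Expand [0 <= | |y|x - |x|y |^2]; both degenerate cases make the inner
product vanish. *)
Lemma Re_dot_le x y : complex.Re (dot x y) <= N x * N y.
Proof.
have [x0|x0] := eqVneq (N x) 0.
  move/eqP: x0; rewrite form_norm_eq0 => /eqP ->.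
  by rewrite linear0l form_norm0 mul0r.
have [y0|y0] := eqVneq (N y) 0.
  move/eqP: y0; rewrite form_norm_eq0 => /eqP ->.
  by rewrite linear0r form_norm0 mulr0.
have Nx : 0 < N x by rewrite lt_def x0 form_norm_ge0.
have Ny : 0 < N y by rewrite lt_def y0 form_norm_ge0.
move: (sqr_ge0 (N (toC (N y) *: x + toC (- N x) *: y))).
rewrite form_normD2 Re_dotZ Re_dotZr !form_normZ !modulus_toC normrN.
rewrite !ger0_norm ?form_norm_ge0 //.
have Nxy : 0 < 2 * (N x * N y) by rewrite !mulr_gt0.
move=> h; rewrite -subr_ge0 -(pmulr_rge0 _ Nxy).
by apply: le_trans h _; lra.
Qed.

Lemma cauchy_schwarz x y : modulus (dot x y) <= N x * N y.
Proof.
have [u u1 uz] := exists_phase (dot x y).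
have := Re_dot_le (u *: x) y.
by rewrite linearZl_LR uz form_normZ u1 mul1r.
Qed.

Lemma form_normD x y : N (x + y) <= N x + N y.
Proof.
rewrite -(@ler_pXn2r _ 2) ?nnegrE ?addr_ge0 ?form_norm_ge0 //.
rewrite form_normD2; have := Re_dot_le x y; nra.
Qed.

Lemma form_norm_sum I (s : seq I) (P : pred I) (F : I -> V) :
  N (\sum_(i <- s | P i) F i) <= \sum_(i <- s | P i) N (F i).
Proof.
elim/big_rec2 : _ => [|i a b _ h]; first by rewrite form_norm0.
by apply: le_trans (form_normD _ _) _; rewrite lerD2l.
Qed.

Lemma form_norm_unit x : x != 0 -> N (toC (N x)^-1 *: x) = 1.
Proof.
rewrite -form_norm_eq0 => x0.
by rewrite form_normZ modulus_toC ger0_norm ?invr_ge0 ?form_norm_ge0 // mulVf.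
Qed.

End InnerProduct.

(** * Bounded operators and their norms *)

Section FormBounded.
Context {R : realType} {V : lmodType (Cplx R)} (dot : {dot V for @Num.conj (Cplx R)}).
Local Notation C := (Cplx R).
Local Notation N := (form_norm dot).

(** [bounded_op] is about the norm of [H]; in terms of the inner product,
boundedness also makes sense on direct sums and on [C^n]. *)
Definition form_bounded (X : V -> V) : Prop :=
  linear X /\ exists M : R, forall x, N (X x) <= M * N x.

Section LinearMap.
Variable X : V -> V.
Hypothesis linX : linear X.
Lemma lin_mapD x y : X (x + y) = X x + X y.
Proof. by have := linX 1 x y; rewrite !scale1r. Qed.
Lemma lin_map0 : X 0 = 0.
Proof. by apply: (addrI (X 0)); rewrite -lin_mapD !addr0. Qed.
Lemma lin_mapZ a x : X (a *: x) = a *: X x.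
Proof. by have := linX a x 0; rewrite !addr0 lin_map0 addr0. Qed.
Lemma lin_mapB x y : X (x - y) = X x - X y.
Proof. by rewrite -scaleN1r lin_mapD lin_mapZ scaleN1r. Qed.
End LinearMap.

Lemma op_norm_le (X : V -> V) (M : R) :
  0 <= M -> (forall x, N (X x) <= M * N x) -> op_norm dot X <= M.
Proof.
move=> M0 h; apply: ge_sup.
  by exists (N (X 0)), 0 => //=; rewrite form_norm0.
by move=> _ [x /= x1 <-]; apply: le_trans (h x) _; rewrite ler_piMr.
Qed.

(** Boundedness is what makes the supremum in [op_norm] meaningful: on an
unbounded set it would be 0. *)
Lemma le_op_norm (X : V -> V) (x : V) :
  form_bounded X -> N (X x) <= op_norm dot X * N x.
Proof.
move=> [linX [M hM]].
have [->|x0] := eqVneq x 0; first by rewrite (lin_map0 linX) form_norm0 mulr0.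
have Nx : 0 < N x by rewrite lt_def form_norm_eq0 x0 form_norm_ge0.
rewrite -ler_pdivrMr // mulrC.
have -> : (N x)^-1 * N (X x) = N (X (toC (N x)^-1 *: x)).
  by rewrite (lin_mapZ linX) form_normZ modulus_toC ger0_norm // invr_ge0 ltW.
apply: sup_upper_bound; last by eexists; [|reflexivity]; rewrite /= form_norm_unit.
split; first by exists (N (X 0)), 0 => //=; rewrite form_norm0.
exists `|M| => _ [y /= y1 <-]; apply: le_trans (hM y) _.
apply: (@le_trans _ _ (`|M| * N y)); first by rewrite ler_wpM2r ?form_norm_ge0 ?ler_norm.
by rewrite ler_piMr.
Qed.

Lemma num_radius_le (X : V -> V) (M : R) :
  0 <= M -> (forall x, N x = 1 -> modulus (dot (X x) x) <= M) ->
  num_radius dot X <= M.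
Proof.
move=> M0 h; rewrite /num_radius; set A := [set _ | _ in _].
have [->|/set0P[a Aa]] := eqVneq A set0; first by rewrite sup0.
by apply: ge_sup; [exists a | move=> _ [x /= x1 <-]; exact: h].
Qed.

Lemma le_num_radius (X : V -> V) (x : V) :
  form_bounded X -> N x = 1 -> modulus (dot (X x) x) <= num_radius dot X.
Proof.
move=> [linX [M hM]] x1; apply: sup_upper_bound; last by exists x.
split; first by exists (modulus (dot (X x) x)), x.
exists M => _ [y /= y1 <-]; apply: le_trans (cauchy_schwarz _ _ _) _.
by have := hM y; rewrite y1 !mulr1.
Qed.

End FormBounded.

Section FormBoundedTheory.
Context {R : realType} {V : lmodType (Cplx R)} (dot : {dot V for @Num.conj (Cplx R)}).
Local Notation C := (Cplx R).
Local Notation N := (form_norm dot).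

Lemma form_bounded_pos (X : V -> V) : form_bounded dot X ->
  exists2 M : R, 0 <= M & forall x, N (X x) <= M * N x.
Proof.
move=> [_ [M hM]]; exists `|M| => // x; apply: le_trans (hM x) _.
by rewrite ler_wpM2r ?form_norm_ge0 ?ler_norm.
Qed.

Lemma op_norm_ge0 (X : V -> V) : 0 <= op_norm dot X.
Proof.
rewrite /op_norm; set A := [set _ | _ in _].
have A0 : A !=set0 by exists (N (X 0)), 0 => //=; rewrite form_norm0.
have [ubA|nubA] := pselect (has_ubound A); last by rewrite sup_out // => -[].
have [a Aa] := A0; apply: le_trans (sup_upper_bound (conj A0 ubA) Aa).
by case: Aa => x _ <-; exact: form_norm_ge0.
Qed.

Lemma form_bounded_id : form_bounded dot id.
Proof. by split=> //; exists 1 => x; rewrite mul1r. Qed.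

Lemma form_boundedD X Y : form_bounded dot X -> form_bounded dot Y ->
  form_bounded dot (fun x => X x + Y x).
Proof.
move=> [lX [M hM]] [lY [M' hM']]; split.
  by move=> a x y; rewrite lX lY scalerDr addrACA.
exists (M + M') => x; apply: le_trans (form_normD _ _ _) _.
by rewrite mulrDl lerD.
Qed.

Lemma form_boundedZ a X : form_bounded dot X -> form_bounded dot (fun x => a *: X x).
Proof.
move=> [lX [M hM]]; split.
  by move=> b x y; rewrite lX scalerDr !scalerA mulrC.
by exists (modulus a * M) => x; rewrite form_normZ -mulrA ler_wpM2l ?modulus_ge0.
Qed.

Lemma form_boundedB X Y : form_bounded dot X -> form_bounded dot Y ->
  form_bounded dot (fun x => X x - Y x).
Proof.
move=> bX bY; have := form_boundedD bX (form_boundedZ (-1) bY).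
by congr form_bounded; apply/funext => x; rewrite scaleN1r.
Qed.

Lemma form_bounded_comp X Y : form_bounded dot X -> form_bounded dot Y ->
  form_bounded dot (X \o Y).
Proof.
move=> bX [lY [M hM]].
have [M' M'0 hM'] := form_bounded_pos bX; split.
  by move=> a x y /=; rewrite lY bX.1.
exists (M' * M) => x /=; apply: le_trans (hM' _) _.
by rewrite -mulrA ler_wpM2l.
Qed.

End FormBoundedTheory.

Section NumRadiusScaled.
Context {R : realType} {V : lmodType (Cplx R)} (dot : {dot V for @Num.conj (Cplx R)}).
Local Notation N := (form_norm dot).

Lemma le_num_radius_scaled (X : V -> V) x : form_bounded dot X ->
  modulus (dot (X x) x) <= num_radius dot X * N x ^+ 2.
Proof.
move=> bX; have [->|x0] := eqVneq x 0.
  by rewrite linear0r modulus0 form_norm0 expr0n mulr0.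
have Nx : 0 < N x by rewrite lt_def form_norm_eq0 x0 form_norm_ge0.
have := le_num_radius bX (form_norm_unit dot x0).
rewrite (lin_mapZ bX.1) linearZl_LR linearZr_LR /= !modulusM.
have -> : modulus (Num.conj (toC (N x)^-1)) = (N x)^-1.
  by rewrite conj_toC modulus_toC ger0_norm // invr_ge0 ltW.
rewrite modulus_toC ger0_norm ?invr_ge0 ?(ltW Nx) // mulrA -expr2 exprVn.
by rewrite ler_pdivrMl ?exprn_gt0 // mulrC.
Qed.

End NumRadiusScaled.

(** * Direct sums and matrices of operators *)

Section DirectSum.
Context {R : realType} {V : lmodType (Cplx R)} (dot : {dot V for @Num.conj (Cplx R)}) (n : nat).
Local Notation C := (Cplx R).
Local Notation W := {ffun 'I_n -> V}.
Local Notation ddot := (dsum_dot dot (n := n)).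

Lemma dsum_dot_bilinear :
  bilinear_for (GRing.Scale.Law.clone _ _ *%R _)
    (GRing.Scale.Law.clone _ _ (@Num.conj C \; *%R) _) ddot.
Proof.
split=> [u'|u] a x y /=; rewrite /dsum_dot mulr_sumr -big_split /=;
  apply: eq_bigr => i _; rewrite !ffunE.
  by rewrite linearDl linearZl_LR.
by rewrite linearDr linearZr_LR.
Qed.

HB.instance Definition _ := bilinear_isBilinear.Build C W W C
  _ _ ddot dsum_dot_bilinear.

Lemma dsum_dot_hermitian x y : ddot x y = (-1) ^+ false * Num.conj (ddot y x).
Proof.
rewrite expr0 mul1r /dsum_dot rmorph_sum /=.
by apply: eq_bigr => i _; exact: dotC.
Qed.

HB.instance Definition _ := isHermitianSesquilinear.Build C W false
  (@Num.conj C) ddot dsum_dot_hermitian.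

Lemma dsum_dot_gt0 x : x != 0 -> 0 < ddot x x.
Proof.
move=> x0; rewrite lt_def; apply/andP; split; last first.
  by apply: sumr_ge0 => i _; exact: dnorm_ge0.
apply: contra_neq x0 => h; apply/ffunP => i; rewrite ffunE; apply/eqP.
rewrite -(dnorm_eq0 dot); apply/eqP; move: h => /eqP.
rewrite psumr_eq0 => [/allP|j _]; last exact: dnorm_ge0.
by move=> /(_ i (mem_index_enum _)) /eqP.
Qed.

HB.instance Definition _ := isDotProduct.Build C W ddot dsum_dot_gt0.

Lemma dsum_norm2 (x : W) : form_norm ddot x ^+ 2 = \sum_i form_norm dot (x i) ^+ 2.
Proof.
apply: toC_inj; rewrite -dotE /= /dsum_dot.
rewrite -[RHS]/(real_complex R _) rmorph_sum /=.
by apply: eq_bigr => i _; rewrite dotE.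
Qed.

Lemma le_dsum_norm (x : W) i : form_norm dot (x i) <= form_norm ddot x.
Proof.
rewrite -(@ler_pXn2r _ 2) ?nnegrE ?form_norm_ge0 // dsum_norm2 (bigD1 i) //=.
by rewrite lerDl sumr_ge0 // => j _; exact: sqr_ge0.
Qed.

Lemma dsum_norm_le (x : W) :
  form_norm ddot x <= \sum_i form_norm dot (x i).
Proof.
have -> : x = \sum_i [ffun k => if k == i then x i else 0].
  apply/ffunP => k; rewrite sum_ffunE (bigD1 k) //= ffunE eqxx big1 ?addr0 //.
  by move=> i ik; rewrite ffunE eq_sym (negbTE ik).
apply: le_trans (form_norm_sum _ _ _ _) _; apply: ler_sum => i _.
rewrite sum_ffunE (bigD1 i) //= ffunE eqxx big1 ?addr0; last first.
  by move=> k ik; rewrite ffunE eq_sym (negbTE ik).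
rewrite -(@ler_pXn2r _ 2) ?nnegrE ?form_norm_ge0 // dsum_norm2 (bigD1 i) //=.
rewrite ffunE eqxx big1 ?addr0 // => k ik.
by rewrite ffunE (negbTE ik) form_norm0 expr0n.
Qed.

(** A crude estimate, but it suffices both for boundedness and for passing to
the limit entry by entry. *)
Lemma mx_op_norm_le (A : 'M[V -> V]_n) (E : 'I_n -> 'I_n -> R) (x : W) :
  (forall i j v, form_norm dot (A i j v) <= E i j * form_norm dot v) ->
  form_norm ddot (mx_op A x) <= (\sum_i \sum_j `|E i j|) * form_norm ddot x.
Proof.
move=> h; apply: le_trans (dsum_norm_le _) _; rewrite mulr_suml.
apply: ler_sum => i _; rewrite ffunE mulr_suml.
apply: le_trans (form_norm_sum _ _ _ _) _; apply: ler_sum => j _.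
apply: le_trans (h _ _ _) _.
apply: (@le_trans _ _ (`|E i j| * form_norm dot (x j))).
  by rewrite ler_wpM2r ?form_norm_ge0 ?ler_norm.
by rewrite ler_wpM2l ?le_dsum_norm.
Qed.

Lemma mx_op_linear (A : 'M[V -> V]_n) :
  (forall i j, linear (A i j)) -> linear (mx_op A).
Proof.
move=> h a x y; apply/ffunP => i; rewrite !ffunE scaler_sumr -big_split /=.
by apply: eq_bigr => j _; rewrite !ffunE h.
Qed.

Lemma mx_op_bounded (A : 'M[V -> V]_n) :
  (forall i j, form_bounded dot (A i j)) -> form_bounded ddot (mx_op A).
Proof.
move=> h; split; first by apply: mx_op_linear => i j; exact: (h i j).1.
have [E hE] := choice (fun ij : 'I_n * 'I_n => (h ij.1 ij.2).2).
exists (\sum_i \sum_j `|E (i, j)|) => x.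
by apply: (mx_op_norm_le (E := fun i j => E (i, j))) => i j v; exact: (hE (i, j)).
Qed.

End DirectSum.

(** * Complex matrices as operators *)

Section ComplexEuclidean.
Context {R : realType}.
Local Notation C := (Cplx R).

Lemma Cdot_bilinear :
  bilinear_for (GRing.Scale.Law.clone _ _ *%R _)
    (GRing.Scale.Law.clone _ _ (@Num.conj C \; *%R) _) (@Cdot R).
Proof.
split=> [w|w] a x y /=; rewrite /Cdot.
  by rewrite mulrDl /GRing.scale /= mulrA.
by rewrite /GRing.scale /= rmorphD rmorphM mulrDr mulrCA.
Qed.

HB.instance Definition _ := bilinear_isBilinear.Build C C^o C^o C
  _ _ (@Cdot R) Cdot_bilinear.

Lemma Cdot_hermitian (x y : C^o) : Cdot x y = (-1) ^+ false * Num.conj (Cdot y x).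
Proof. by rewrite expr0 mul1r /Cdot rmorphM /= conjCK mulrC. Qed.

HB.instance Definition _ := isHermitianSesquilinear.Build C C^o false
  (@Num.conj C) (@Cdot R) Cdot_hermitian.

Lemma Cdot_gt0 (x : C^o) : x != 0 -> 0 < Cdot x x.
Proof. by move=> x0; rewrite /Cdot -normCK exprn_gt0 ?normr_gt0. Qed.

HB.instance Definition _ := isDotProduct.Build C C^o (@Cdot R) Cdot_gt0.

Lemma Cdot_norm (z : C^o) : form_norm (@Cdot R) z = modulus z.
Proof.
apply/eqP; rewrite -(@eqrXn2 _ 2) ?form_norm_ge0 ?modulus_ge0 //.
by rewrite -(inj_eq (@toC_inj R)) -dotE /= /Cdot -normCK normC_modulus toCX.
Qed.

(** The operator whose norm is [mx_norm2 A]. *)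
Definition mulop (n : nat) (A : 'M[C]_n) :=
  mx_op (map_mx (fun (a : C) (z : C^o) => (a * z : C^o)) A).

Lemma mulop_bounded n (A : 'M[C]_n) :
  form_bounded (dsum_dot (@Cdot R) (n := n)) (mulop A).
Proof.
apply: mx_op_bounded => i j; rewrite mxE; split.
  by move=> a x y; rewrite mulrDr /GRing.scale /= mulrCA.
by exists (modulus (A i j)) => z; rewrite !Cdot_norm modulusM.
Qed.

End ComplexEuclidean.

(** * Polynomials and rational functions of an operator *)

Section PolynomialCalculus.
Context {R : realType} {H : completeNormedModType (Cplx R)}.
Local Notation C := (Cplx R).
Variable T : H -> H.
Hypothesis linT : linear T.
Implicit Types p q : {poly C}.

(** Sums of a common length make the calculus additive in spite of the
dependence of [size p] on cancellations. *)
Lemma poly_op_widen n p x : (size p <= n)%N ->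
  poly_op T p x = \sum_(i < n) p`_i *: iter i T x.
Proof.
move=> pn; rewrite /poly_op (big_ord_widen n (fun i => p`_i *: iter i T x) pn).
rewrite big_mkcond; apply: eq_bigr => i _; case: ltnP => // pi.
by rewrite nth_default // scale0r.
Qed.

Lemma poly_opD p q x : poly_op T (p + q) x = poly_op T p x + poly_op T q x.
Proof.
rewrite (poly_op_widen _ (size_polyD p q)).
rewrite (poly_op_widen (p := p) _ (leq_maxl _ (size q))).
rewrite (poly_op_widen (p := q) _ (leq_maxr (size p) _)) -big_split /=.
by apply: eq_bigr => i _; rewrite coefD scalerDl.
Qed.

Lemma poly_opZ a p x : poly_op T (a *: p) x = a *: poly_op T p x.
Proof.
rewrite (poly_op_widen _ (size_scale_leq a p)) /poly_op scaler_sumr.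
by apply: eq_bigr => i _; rewrite coefZ scalerA.
Qed.

Lemma poly_opC a x : poly_op T a%:P x = a *: x.
Proof.
by rewrite (poly_op_widen _ (size_polyC_leq1 a)) big_ord1 coefC eqxx.
Qed.

Lemma poly_opMX p x : poly_op T (p * 'X) x = poly_op T p (T x).
Proof.
have s : (size (p * 'X)%R <= (size p).+1)%N.
  by have [->|p0] := eqVneq p 0; rewrite ?mul0r ?size_poly0 // size_mulX.
rewrite (poly_op_widen _ s) big_ord_recl coefMX eqxx scale0r add0r.
by apply: eq_bigr => i _; rewrite coefMX /= -iterSr.
Qed.

Lemma poly_opX x : poly_op T 'X x = T x.
Proof. by rewrite -['X]mul1r poly_opMX -polyC1 poly_opC scale1r. Qed.

Lemma poly_op_linear p : linear (poly_op T p).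
Proof.
move=> a x y; elim/poly_ind: p x y => [|p c IH] x y.
  by rewrite -polyC0 !poly_opC !scale0r scaler0 addr0.
rewrite !poly_opD !poly_opMX !poly_opC linT IH !scalerDr !scalerA (mulrC c a).
by rewrite addrACA.
Qed.

Lemma poly_op_comm p x : poly_op T p (T x) = T (poly_op T p x).
Proof.
elim/poly_ind: p x => [|p c IH] x.
  by rewrite -polyC0 !poly_opC !scale0r (lin_map0 linT).
by rewrite !poly_opD !poly_opMX !poly_opC (lin_mapD linT) (lin_mapZ linT) IH.
Qed.

Lemma poly_opM p q x : poly_op T (p * q) x = poly_op T p (poly_op T q x).
Proof.
elim/poly_ind: p q x => [|p c IH] q x.
  by rewrite mul0r -polyC0 !poly_opC !scale0r.
rewrite mulrDl -mulrA (mulrC 'X) mulrA mul_polyC !poly_opD !poly_opMX poly_opZ.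
by rewrite IH poly_op_comm poly_opC.
Qed.

Lemma poly_opN p x : poly_op T (- p) x = - poly_op T p x.
Proof. by rewrite -scaleN1r poly_opZ scaleN1r. Qed.

Lemma poly_op_comp_comm p q x :
  poly_op T p (poly_op T q x) = poly_op T q (poly_op T p x).
Proof. by rewrite -!poly_opM mulrC. Qed.

End PolynomialCalculus.

Section RationalCalculus.
Context {R : realType} {H : completeNormedModType (Cplx R)}.
Local Notation C := (Cplx R).
Variable dot : {dot H for @Num.conj (Cplx R)}.
Hypothesis norm_dot : forall x : H, `|x| ^+ 2 = dot x x.
Local Notation N := (form_norm dot).

Lemma normr_form_norm x : `|x| = toC (N x) :> C.
Proof.
apply/eqP; rewrite -(@eqrXn2 _ 2) //; last by rewrite -toC0 toC_le form_norm_ge0.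
by rewrite norm_dot dotE toCX.
Qed.

Lemma bounded_opP X : bounded_op X <-> form_bounded dot X.
Proof.
split=> -[lX [M hM]]; split=> //.
  exists (complex.Re M) => x; move: (hM x); rewrite !normr_form_norm.
  by rewrite lecE => /andP[_]; rewrite mulrC ReZ mulrC.
by exists (toC M) => x; rewrite !normr_form_norm -toCM toC_le.
Qed.

Variable T : H -> H.
Hypothesis bT : bounded_op T.
Let linT : linear T := bT.1.
Variable K : set C.
Hypothesis sTK : spectrum T `<=` K.

Lemma poly_op_bounded p : form_bounded dot (poly_op T p).
Proof.
elim/poly_ind: p => [|p c IH].
  have := form_boundedZ 0 (form_bounded_id dot).
  by congr form_bounded; apply/funext => x; rewrite -polyC0 poly_opC.
have := form_boundedD (form_bounded_comp IH (iffLR (bounded_opP T) bT))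
  (form_boundedZ c (form_bounded_id dot)).
by congr form_bounded; apply/funext => x; rewrite poly_opD poly_opMX poly_opC.
Qed.

Definition invertible_op (X : H -> H) :=
  exists S, [/\ form_bounded dot S, cancel X S & cancel S X].

Lemma invertible_op_comp X Y :
  invertible_op X -> invertible_op Y -> invertible_op (X \o Y).
Proof.
move=> [S [bS XS SX]] [S' [bS' YS SY]]; exists (S' \o S).
by split; [exact: form_bounded_comp | exact: can_comp | exact: can_comp].
Qed.

Lemma invertible_resolvent (z : C) : ~ K z -> invertible_op (poly_op T ('X - z%:P)).
Proof.
move=> nKz; have : ~ spectrum T z by move=> /sTK.
move=> /contrapT [S [bS c1 c2]]; exists S; split.
- exact/bounded_opP.
- by move=> x; rewrite poly_opD poly_opX // -polyCN poly_opC scaleNr.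
- by move=> x; rewrite poly_opD poly_opX // -polyCN poly_opC scaleNr.
Qed.

(** Over the complex numbers [q] is a product of linear factors [X - z] with
[z] outside [K], hence outside the spectrum, and each of them is invertible at
[T]. *)
Lemma invertible_poly_op (q : {poly C}) : q != 0 -> (forall z, K z -> q.[z] != 0) ->
  invertible_op (poly_op T q).
Proof.
move=> q0 qK; have [s qs] := closed_field_poly_normal q.
have: {in s, forall z, ~ K z}.
  move=> z zs /qK /negP; apply; rewrite qs hornerZ horner_prod.
  by rewrite (big_rem z) //= hornerXsubC subrr mul0r mulr0.
rewrite {}qs; have : lead_coef q != 0 by rewrite lead_coef_eq0.
move: (lead_coef q) => a a0 {q q0 qK}.
elim: s => [|z s IH] hs.
  rewrite big_nil; exists (fun x => a^-1 *: x); split.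
  - exact: form_boundedZ (form_bounded_id _).
  - by move=> x; rewrite -[_ *: 1]/(a%:A) alg_polyC poly_opC scalerA mulVf // scale1r.
  - by move=> x; rewrite -[_ *: 1]/(a%:A) alg_polyC poly_opC scalerA mulfV // scale1r.
rewrite big_cons scalerAr.
have -> : poly_op T (('X - z%:P) * (a *: \prod_(j <- s) ('X - j%:P))) =
   poly_op T ('X - z%:P) \o poly_op T (a *: \prod_(j <- s) ('X - j%:P)).
  by apply/funext => x; rewrite poly_opM.
apply: invertible_op_comp.
  by apply: invertible_resolvent; apply: hs; rewrite mem_head.
by apply: IH => w ws; apply: hs; rewrite in_cons ws orbT.
Qed.

Lemma invertible_pinv (X : H -> H) : invertible_op X ->
  [/\ form_bounded dot (pinv setT X), cancel X (pinv setT X) & cancel (pinv setT X) X].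
Proof.
move=> [S [bS XS SX]].
have XP : cancel X (pinv setT X).
  by move=> x; apply: pinvKV; rewrite ?inE // => y z _ _; exact: (can_inj XS).
have -> : pinv setT X = S by apply/funext => x; rewrite -{1}[x]SX XP.
by [].
Qed.

Section Ratio.
Variable r : {ratio {poly C}}.
Hypothesis rK : poles_off K r.

Lemma invertible_denom : invertible_op (poly_op T (frac r).2).
Proof. by apply: invertible_poly_op => //; exact: denom_ratioP. Qed.

Lemma denom_op_inj : injective (poly_op T (frac r).2).
Proof. by have [S [_ c1 _]] := invertible_denom; exact: can_inj c1. Qed.

Lemma rat_op_bounded : form_bounded dot (rat_op T r).
Proof.
apply: form_bounded_comp; first exact: poly_op_bounded.
by have [] := invertible_pinv invertible_denom.
Qed.

(** Together with the injectivity of the denominator this determines the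
operator; it is how identities between rational functions of [T] are
verified. *)
Lemma rat_opP x : poly_op T (frac r).2 (rat_op T r x) = poly_op T (frac r).1 x.
Proof.
have [_ _ c2] := invertible_pinv invertible_denom.
by rewrite /rat_op /= poly_op_comp_comm // c2.
Qed.

End Ratio.
End RationalCalculus.

(** * Rational functions and their uniform limits on a compact set *)

Section RationalFunctions.
Context {R : realType}.
Local Notation C := (Cplx R).

Lemma ballCE (z w : C) (e : R) : ball z (toC e) w = (modulus (z - w) < e) :> Prop.
Proof.
rewrite -ball_normE /ball_ /=; congr is_true.
by rewrite normC_modulus /toC ltcR.
Qed.

Lemma modulus_continuous : continuous (@modulus R : C -> R).
Proof.
move=> z; apply/(@cvgrPdist_lt _ _ _ (nbhs z) (nbhs_filter z)) => e e0.
have e1 : 0 < toC e by rewrite -toC0 /toC ltcR.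
apply: (@filterS _ (nbhs z) (nbhs_filter z) _ _ _ (near_ball z _ e1)) => w.
rewrite ballCE.
apply: le_lt_trans; rewrite ler_norml; apply/andP; split.
  rewrite lerNl opprB lerBlDr -[modulus (z - w)]modulusN opprB.
  by apply: le_trans (modulusD _ _); rewrite subrK.
by rewrite lerBlDr; apply: le_trans (modulusD _ _); rewrite subrK.
Qed.

Lemma hornerC_continuous (p : {poly C}) : continuous (fun z : C => p.[z]).
Proof.
elim/poly_ind: p => [|p c IH] z.
  by under eq_fun do rewrite horner0; exact: cst_continuous.
under eq_fun do rewrite hornerMXaddC.
apply: (@continuousD _ _ _ (fun z : C => p.[z] * z) (fun=> c)).
  by apply: (@continuousM _ _ (fun z : C => p.[z]) id); [exact: IH | exact: id].
exact: cst_continuous.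
Qed.

Variable K : set C.
Hypothesis cK : compact K.

Lemma rat_eval_continuous r : poles_off K r -> {within K, continuous (rat_eval r)}.
Proof.
move=> rK; apply: continuous_in_subspaceT => z /set_mem Kz.
apply: (@continuousM _ _ (fun z : C => (frac r).1.[z])
  (fun z : C => (frac r).2.[z]^-1)); first exact: hornerC_continuous.
apply: (@continuousV _ _ (fun z : C => (frac r).2.[z])); first exact: rK.
exact: hornerC_continuous.
Qed.

Lemma map_mx_rat_eval n (F : 'M[{ratio {poly C}}]_n) z :
  map_mx (fun f : C -> C => f z) (map_mx (@rat_eval R) F) = map_mx (rat_eval^~ z) F.
Proof. by apply/matrixP => i j; rewrite !mxE. Qed.

Lemma RK_rat_eval r : poles_off K r -> RK K (rat_eval r).
Proof.
move=> rK; split; first exact: rat_eval_continuous.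
by apply: subset_closure; exists r.
Qed.

Lemma RK_approx (f : C -> C) (e : R) : RK K f -> 0 < e ->
  exists2 r, poles_off K r & forall z, K z -> modulus (rat_eval r z - f z) <= e.
Proof.
move=> [_ cf] e0.
have e1 : 0 < toC e by rewrite -toC0 /toC ltcR.
have := cf [set h : {uniform` K -> C} | forall z, K z -> ball (f z) (toC e) (h z)].
case.
  apply/uniform_nbhs; exists [set xy : C * C | ball xy.1 (toC e) xy.2]; split => //.
  exact: (entourage_ball _ (PosNum e1)).
move=> _ [[r rK <-] h]; exists r => // z /h; rewrite ballCE => hz.
by rewrite -modulusN opprB ltW.
Qed.

(** Compactness of [K] enters here: it makes the supremum in [sup_norm] a
bound for the values of the matrix function. *)
Lemma RK_bounded (f : C -> C) : RK K f ->
  exists2 B : R, 0 <= B & forall z, K z -> modulus (f z) <= B.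
Proof.
move=> [cf _].
have cmf : {within K, continuous (@modulus R \o f)}.
  move=> z; apply: (@continuous_comp (subspace K) C R f (@modulus R)).
    exact: cf.
  exact: modulus_continuous.
have [M [_ hM]] := compact_bounded (continuous_compact cmf cK).
exists (`|M| + 1); first by rewrite addr_ge0.
move=> z Kz.
have ltM : M < `|M| + 1 by apply: le_lt_trans (ler_norm M) _; rewrite ltrDl.
apply: le_trans (ler_norm _) _; apply: (hM _ ltM (modulus (f z))).
by exists z.
Qed.

Lemma mx_norm2_le n (A : 'M[C]_n) : mx_norm2 A <= \sum_i \sum_j modulus (A i j).
Proof.
have h : forall x, form_norm (dsum_dot (@Cdot R) (n := n)) (mulop A x) <=
    (\sum_i \sum_j modulus (A i j)) * form_norm (dsum_dot (@Cdot R) (n := n)) x.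
  move=> x; have -> : \sum_i \sum_j modulus (A i j) = \sum_i \sum_j `|modulus (A i j)|.
    by apply: eq_bigr => i _; apply: eq_bigr => j _; rewrite ger0_norm ?modulus_ge0.
  by apply: mx_op_norm_le => i j v; rewrite mxE !Cdot_norm modulusM.
apply: op_norm_le h.
by apply: sumr_ge0 => i _; apply: sumr_ge0 => j _; exact: modulus_ge0.
Qed.

Lemma mx_norm2_ge0 n (A : 'M[C]_n) : 0 <= mx_norm2 A.
Proof. exact: op_norm_ge0. Qed.

Lemma le_mx_norm2 n (A : 'M[C]_n) x :
  form_norm (dsum_dot (@Cdot R) (n := n)) (mulop A x) <=
  mx_norm2 A * form_norm (dsum_dot (@Cdot R) (n := n)) x.
Proof. exact: le_op_norm (mulop_bounded A). Qed.

Lemma le_sup_norm n (F : 'M[C -> C]_n) z :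
  (forall i j, RK K (F i j)) -> K z ->
  mx_norm2 (map_mx (fun f : C -> C => f z) F) <= sup_norm K F.
Proof.
move=> FK Kz; apply: sup_upper_bound; last by exists z.
split; first by eexists; exists z.
have [B hB] := choice (fun ij : 'I_n * 'I_n =>
  let: ex_intro2 B _ hB := RK_bounded (FK ij.1 ij.2) in ex_intro _ B hB).
exists (\sum_i \sum_j B (i, j)) => _ [w Kw <-].
apply: le_trans (mx_norm2_le _) _.
by apply: ler_sum => i _; apply: ler_sum => j _; rewrite mxE (hB (i, j)).
Qed.

Lemma sup_norm_ge0 n (F : 'M[C -> C]_n) :
  (forall i j, RK K (F i j)) -> 0 <= sup_norm K F.
Proof.
move=> FK; rewrite /sup_norm; set A := [set _ | _ in _].
have [->|/set0P[_ [z Kz _]]] := eqVneq A set0; first by rewrite sup0.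
exact: le_trans (mx_norm2_ge0 _) (le_sup_norm FK Kz).
Qed.

Lemma sup_norm_le n (F : 'M[C -> C]_n) (M : R) : 0 <= M ->
  (forall z, K z -> mx_norm2 (map_mx (fun f : C -> C => f z) F) <= M) ->
  sup_norm K F <= M.
Proof.
move=> M0 h; rewrite /sup_norm; set A := [set _ | _ in _].
have [->|/set0P[a Aa]] := eqVneq A set0; first by rewrite sup0.
by apply: ge_sup; [exists a | move=> _ [x /= x1 <-]; exact: h].
Qed.

End RationalFunctions.

(** * The calculus under the spectral set inequality *)

(** The form in which limits are taken: an error of size [e * b] for every [e]. *)
Lemma ler_mul_eps (R : realFieldType) (a b d : R) :
  0 <= b -> (forall e, 0 < e -> a <= d + e * b) -> a <= d.
Proof.
move=> b0 h; apply/ler_addgt0Pr => e e0.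
have b1 : 0 < b + 1 by rewrite ltr_wpDl.
apply: le_trans (h (e / (b + 1)) _) _; first by rewrite divr_gt0.
by rewrite lerD2l -mulrA ler_piMr ?(ltW e0) // mulrC ler_pdivrMr // mul1r lerDl.
Qed.

Section Ratios.
Context {R : realType}.
Local Notation C := (Cplx R).
Variable K : set C.
Implicit Types p q : {poly C}.

Lemma poles_off_Ratio p q : q != 0 -> (forall z, K z -> q.[z] != 0) ->
  poles_off K (Ratio p q).
Proof. by move=> q0 qK z Kz; rewrite denom_Ratio ?qK. Qed.

Lemma rat_eval_Ratio p q z : q != 0 -> rat_eval (Ratio p q) z = p.[z] / q.[z].
Proof. by move=> q0; rewrite /rat_eval !numden_Ratio. Qed.

(** A difference of fractions with the product of the two denominators, so that
its poles are off [K] when those of [r] and [s] are. *)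
Definition ratio_sub (r s : {ratio {poly C}}) :=
  Ratio ((frac r).1 * (frac s).2 - (frac s).1 * (frac r).2) ((frac r).2 * (frac s).2).

Section Sub.
Variables r s : {ratio {poly C}}.
Hypotheses (rK : poles_off K r) (sK : poles_off K s).

Lemma ratio_sub_denom_neq0 : (frac r).2 * (frac s).2 != 0.
Proof. by rewrite mulf_neq0 ?denom_ratioP. Qed.

Lemma poles_off_sub : poles_off K (ratio_sub r s).
Proof.
apply: poles_off_Ratio; first exact: ratio_sub_denom_neq0.
by move=> z Kz; rewrite hornerM mulf_neq0 ?rK ?sK.
Qed.

Lemma rat_eval_sub z : K z ->
  rat_eval (ratio_sub r s) z = rat_eval r z - rat_eval s z.
Proof.
move=> Kz; rewrite rat_eval_Ratio ?ratio_sub_denom_neq0 // !hornerE /rat_eval.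
by field; rewrite ?rK ?sK.
Qed.
End Sub.
End Ratios.

Section Calculus.
Context {R : realType} {H : completeNormedModType (Cplx R)}.
Local Notation C := (Cplx R).
Variable dot : {dot H for @Num.conj (Cplx R)}.
Hypothesis norm_dot : forall x : H, `|x| ^+ 2 = dot x x.
Local Notation N := (form_norm dot).
Variable T : H -> H.
Hypothesis bT : bounded_op T.
Variable K : set C.
Hypothesis sTK : spectrum T `<=` K.
Let linT : linear T := bT.1.

Lemma rat_op_eq r x y : poles_off K r ->
  poly_op T (frac r).2 y = poly_op T (frac r).1 x -> rat_op T r x = y.
Proof.
move=> rK h; apply: (denom_op_inj norm_dot bT sTK rK).
by rewrite (rat_opP norm_dot bT sTK rK) h.
Qed.

Lemma rat_op_sub r s x : poles_off K r -> poles_off K s ->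
  rat_op T (ratio_sub r s) x = rat_op T r x - rat_op T s x.
Proof.
move=> rK sK; apply: rat_op_eq; first exact: poles_off_sub.
rewrite !numden_Ratio ?ratio_sub_denom_neq0 //.
rewrite (lin_mapB (poly_op_linear linT _)) poly_opD poly_opN.
congr (_ - _).
  rewrite [in LHS]mulrC poly_opM // (rat_opP norm_dot bT sTK) //.
  by rewrite -poly_opM // mulrC.
rewrite poly_opM // (rat_opP norm_dot bT sTK) //.
by rewrite -poly_opM // mulrC.
Qed.

(** The constant approximation of [rat_eval r] by [r] itself shows that the
extended calculus agrees with the rational one. *)
Lemma RK_calculus_rat r X : poles_off K r ->
  RK_calculus dot K T (rat_eval r) X -> X = rat_op T r.
Proof.
move=> rK [bX hX]; apply/funext => x; apply/eqP.
rewrite eq_sym -subr_eq0 -(form_norm_eq0 dot) eq_le form_norm_ge0 andbT.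
apply: (@ler_mul_eps _ _ (N x)); first exact: form_norm_ge0.
move=> e e0; rewrite add0r.
have [d d0 hd] := hX e e0.
have b : form_bounded dot (fun x => rat_op T r x - X x).
  apply: form_boundedB; first exact: (rat_op_bounded norm_dot bT sTK).
  exact/(bounded_opP norm_dot).
apply: le_trans (le_op_norm x b) _.
rewrite ler_wpM2r ?form_norm_ge0 // hd // => z _.
by rewrite subrr modulus0 ltW.
Qed.

Lemma spectral_mx_op_le c n (F : 'M[{ratio {poly C}}]_n) (M : R) x :
  0 <= c -> complete_spectral_set dot c K T -> (0 < n)%N ->
  (forall i j, poles_off K (F i j)) -> 0 <= M ->
  (forall z, K z -> mx_norm2 (map_mx (rat_eval^~ z) F) <= M) ->
  form_norm (dsum_dot dot (n := n)) (mx_op (map_mx (rat_op T) F) x) <=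
    c * M * form_norm (dsum_dot dot (n := n)) x.
Proof.
move=> c0 [_ hS] n0 FK M0 hF.
have b : form_bounded (dsum_dot dot (n := n)) (mx_op (map_mx (rat_op T) F)).
  by apply: mx_op_bounded => i j; rewrite mxE; exact: (rat_op_bounded norm_dot bT sTK).
apply: le_trans (le_op_norm x b) _; rewrite ler_wpM2r ?form_norm_ge0 //.
apply: le_trans (hS n F n0 FK) _; rewrite ler_wpM2l //.
by apply: sup_norm_le => // z Kz; rewrite map_mx_rat_eval hF.
Qed.

(** The spectral set inequality for the 1 by 1 matrix [r - s]: closeness on [K]
implies closeness at [T]. *)
Lemma spectral_dist_le c r s (e : R) x :
  0 <= c -> complete_spectral_set dot c K T -> poles_off K r -> poles_off K s ->
  0 <= e -> (forall z, K z -> modulus (rat_eval r z - rat_eval s z) <= e) ->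
  N (rat_op T r x - rat_op T s x) <= c * e * N x.
Proof.
move=> c0 hS rK sK e0 h.
have tK := poles_off_sub rK sK.
have := @spectral_mx_op_le c 1 (const_mx (ratio_sub r s)) e [ffun=> x] c0 hS erefl.
have -> : form_norm (dsum_dot dot (n:=1)) [ffun=> x] = N x.
  apply/eqP; rewrite -(@eqrXn2 _ 2) ?form_norm_ge0 // dsum_norm2 big_ord1 ffunE.
  by [].
move=> hb; apply: le_trans (hb _ e0 _).
- apply: le_trans (le_dsum_norm _ _ ord0).
  by rewrite ffunE big_ord1 !mxE ffunE rat_op_sub.
- by move=> i j; rewrite mxE.
- move=> z Kz; apply: le_trans (mx_norm2_le _) _.
  by rewrite !big_ord1 !mxE (rat_eval_sub rK sK Kz) h.
Qed.

Section Extension.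
Variables (c : R) (f : C -> C).
Hypotheses (c0 : 0 < c) (hS : complete_spectral_set dot c K T) (fK : RK K f).

(** If [r k] tends to [f] uniformly on [K], then [rat_op T (r k) x] is a Cauchy
sequence by [spectral_dist_le]; its limit defines [X x], with
[N (rat_op T s x - X x) <= c * d * N x] as soon as [s] is within [d] of [f] on
[K]. *)
Lemma RK_calculus_exists : exists X, RK_calculus dot K T f X.
Proof.
have hr k : exists r, poles_off K r /\
    forall z, K z -> modulus (rat_eval r z - f z) <= k.+1%:R^-1.
  have k0 : 0 < k.+1%:R^-1 :> R by rewrite invr_gt0 ltr0n.
  by have [r rK h] := RK_approx fK k0; exists r.
have [r /all_and2 [rK rf]] := choice hr.
pose u x k := rat_op T (r k) x.
have c00 := ltW c0.
have close s (d : R) k x : poles_off K s -> 0 <= d ->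
    (forall z, K z -> modulus (rat_eval s z - f z) <= d) ->
    N (rat_op T s x - u x k) <= c * (d + k.+1%:R^-1) * N x.
  move=> sK d0 hs; apply: spectral_dist_le => //; first by rewrite addr_ge0 ?invr_ge0.
  move=> z Kz; rewrite -(subrKA (f z)); apply: le_trans (modulusD _ _) _.
  by rewrite lerD ?hs // -opprB modulusN rf.
have cu x : cvgn (u x).
  apply/cauchy_cvgP; apply: cauchy_exP => e' e'0.
  have e'E : e' = toC (complex.Re e') by rewrite /toC RRe_real // gtr0_real.
  set e := complex.Re e' in e'E.
  have e0 : 0 < e by rewrite -ltcR -[(e%:C)%C]/(toC e) -e'E.
  have [k hk] : exists k, c * (k.+1%:R^-1 + k.+1%:R^-1) * N x < e.
    have b0 : 0 <= c * N x * 2 by rewrite !mulr_ge0 ?form_norm_ge0.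
    exists (Num.bound (c * N x * 2 / e)).
    have := archi_boundP (divr_ge0 b0 (ltW e0)).
    rewrite ltr_pdivrMr // => hb.
    set k := Num.bound _ in hb *.
    have -> : c * (k.+1%:R^-1 + k.+1%:R^-1) * N x = c * N x * 2 / k.+1%:R by ring.
    rewrite ltr_pdivrMr ?ltr0n //; apply: lt_trans hb _.
    by rewrite mulrC ltr_pM2l // ltr_nat.
  exists (u x k); exists k => // l /= kl.
  rewrite -ball_normE /ball_ /= (normr_form_norm norm_dot) e'E /toC ltcR.
  apply: le_lt_trans hk; have k0 : 0 <= k.+1%:R^-1 :> R by rewrite invr_ge0.
  apply: le_trans (close _ _ l x (rK k) k0 (rf k)) _.
  rewrite ler_wpM2r ?form_norm_ge0 // ler_wpM2l // lerD2l.
  by rewrite lef_pV2 ?posrE ?ltr0n // ler_nat.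
pose X x := limn (u x).
have Xu x (e : R) : 0 < e -> exists k0, forall k, (k0 <= k)%N -> N (u x k - X x) <= e.
  move=> e0; have e1 : 0 < toC e by rewrite -toC0 /toC ltcR.
  have /cvgrPdist_lt /(_ _ e1) [k0 _ hk] := cu x; exists k0 => k /hk.
  by rewrite (normr_form_norm norm_dot) /toC ltcR -form_normN opprB => /ltW.
have closeX s (d : R) x : poles_off K s -> 0 <= d ->
    (forall z, K z -> modulus (rat_eval s z - f z) <= d) ->
    N (rat_op T s x - X x) <= c * d * N x.
  move=> sK d0 hs; apply: (@ler_mul_eps _ _ (c * N x + 1)).
    by rewrite addr_ge0 ?mulr_ge0 ?form_norm_ge0.
  move=> e e0; have [k0 hk] := Xu x e e0.
  pose k := maxn k0 (Num.bound e^-1).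
  have ke : k.+1%:R^-1 <= e.
    rewrite -[e]invrK lef_pV2 ?posrE ?invr_gt0 ?ltr0n //.
    have := archi_boundP (ltW (etrans (invr_gt0 e) e0)).
    move=> /ltW /le_trans; apply; rewrite ler_nat.
    by rewrite (leq_trans (leq_maxr k0 _)).
  rewrite -(subrKA (u x k)); apply: le_trans (form_normD _ _ _) _.
  apply: (@le_trans _ _ (c * (d + e) * N x + e)); last by lra.
  rewrite lerD ?hk ?leq_maxl //.
  apply: le_trans (close _ _ k _ sK d0 hs) _.
  by rewrite ler_wpM2r ?form_norm_ge0 // ler_wpM2l // lerD2l.
have linX : linear X.
  move=> a x y; apply: cvg_lim => //.
  have -> : u (a *: x + y) = (fun k => a *: u x k + u y k).
    by apply/funext => k; exact: (rat_op_bounded norm_dot bT sTK (rK k)).1.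
  by apply: cvgD; [apply: cvgZr; exact: cu | exact: cu].
have bX : form_bounded dot X.
  split=> //.
  have [M hM] := (rat_op_bounded norm_dot bT sTK (rK 0)).2.
  exists (M + c * 1) => x; rewrite mulrDl.
  rewrite -[X x](subrK (u x 0)) addrC; apply: le_trans (form_normD _ _ _) _.
  rewrite lerD ?hM // -opprB form_normN closeX // => z Kz.
  by apply: le_trans (rf _ _ Kz) _; rewrite invr1.
exists X; split; first exact/(bounded_opP norm_dot).
move=> e e0; exists (e / c); first exact: divr_gt0.
move=> s sK hs; apply: op_norm_le; first exact: ltW.
move=> x; apply: le_trans (closeX s (e / c) x sK _ hs) _; first by rewrite divr_ge0 // ltW.
by rewrite mulrC [c * _]mulrC divfK // ?gt_eqF // mulrC.
Qed.

End Extension.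
End Calculus.

(** * Matrices over a commutative ring of operators *)

Section MatrixAction.
Context {R : realType} {V : lmodType (Cplx R)} {A : comNzRingType}.
Variable phi : A -> V -> V.
Hypothesis phi_linear : forall a, linear (phi a).
Hypothesis phiD : forall a b x, phi (a + b) x = phi a x + phi b x.
Hypothesis phiM : forall a b x, phi (a * b) x = phi a (phi b x).
Variable n : nat.
Implicit Types M : 'M[A]_n.

(** A ring [A] that acts linearly on [V] makes matrices over [A] act on [V^n],
and matrix products become compositions.  This is used for scalars acting on
[C] and for polynomials acting through [T]. *)
Definition mx_act M := mx_op (map_mx phi M).

Lemma act0 x : phi 0 x = 0.
Proof. by apply: (addrI (phi 0 x)); rewrite -phiD !addr0. Qed.

Lemma act_suml I (s : seq I) (F : I -> A) x :
  phi (\sum_(i <- s) F i) x = \sum_(i <- s) phi (F i) x.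
Proof. by elim/big_rec2: _ => [|i a b _ <-]; rewrite ?phiD // act0. Qed.

Lemma act_sumr I (s : seq I) a (F : I -> V) :
  phi a (\sum_(i <- s) F i) = \sum_(i <- s) phi a (F i).
Proof.
elim/big_rec2: _ => [|i x y _ <-]; first exact: lin_map0.
exact: lin_mapD.
Qed.

Lemma mx_act_linear M : linear (mx_act M).
Proof. by apply: mx_op_linear => i j; rewrite mxE; exact: phi_linear. Qed.

Lemma mx_actM M M' x : mx_act (M *m M') x = mx_act M (mx_act M' x).
Proof.
apply/ffunP => i; rewrite !ffunE.
under eq_bigr do rewrite !mxE act_suml.
rewrite exchange_big /=; apply: eq_bigr => j _; rewrite !mxE !ffunE act_sumr.
by apply: eq_bigr => k _; rewrite !mxE phiM.
Qed.

Lemma mx_actD M M' x : mx_act (M + M') x = mx_act M x + mx_act M' x.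
Proof.
apply/ffunP => i; rewrite !ffunE -big_split /=.
by apply: eq_bigr => j _; rewrite !mxE phiD.
Qed.

Lemma mx_act_scalar a x : mx_act a%:M x = [ffun i => phi a (x i)].
Proof.
apply/ffunP => i; rewrite !ffunE (bigD1 i) //= !mxE eqxx big1 ?addr0 //.
by move=> j ij; rewrite !mxE eq_sym (negbTE ij) act0.
Qed.

Lemma mx_actZ a M x : mx_act (a *: M) x = mx_act a%:M (mx_act M x).
Proof. by rewrite -mul_scalar_mx mx_actM. Qed.

End MatrixAction.

Section ComplexMatrixAction.
Context {R : realType}.
Local Notation C := (Cplx R).
Variable n : nat.
Implicit Types (A : 'M[C]_n) (v : {ffun 'I_n -> C^o}).

Let mulC_linear (a : C) : linear (fun z : C^o => (a * z : C^o)).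
Proof. by move=> b x y; rewrite mulrDr /GRing.scale /= mulrCA. Qed.

Lemma mulopM A B v : mulop (A *m B) v = mulop A (mulop B v).
Proof.
apply: (mx_actM mulC_linear) => [a b x|a b x].
  exact: mulrDl.
exact/esym/mulrA.
Qed.

Lemma mulopD A B v : mulop (A + B) v = mulop A v + mulop B v.
Proof. by apply: mx_actD => a b x; exact: mulrDl. Qed.

Lemma mulopZ a A v : mulop (a *: A) v = a *: mulop A v.
Proof.
apply/ffunP => i; rewrite !ffunE scaler_sumr; apply: eq_bigr => j _.
by rewrite !mxE -mulrA.
Qed.

Lemma mulopN A v : mulop (- A) v = - mulop A v.
Proof. by rewrite -scaleN1r mulopZ scaleN1r. Qed.

Lemma mulop_scalar a v : mulop a%:M v = a *: v.
Proof.
apply: etrans (mx_act_scalar _ _ _) _ => [b d x|]; first exact: mulrDl.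
by apply/ffunP => i; rewrite !ffunE.
Qed.

(** In finite dimension injectivity gives invertibility; this is how a lower bound
on the operator is turned into a statement on the determinant. *)
Lemma det_neq0_mulop A : (forall v, v != 0 -> mulop A v != 0) -> \det A != 0.
Proof.
move=> h; rewrite -det_tr; apply/negP => /det0P [v v0 vA].
have /h /eqP : [ffun i => v 0 i : C^o] != 0.
  apply: contra_neq v0 => /ffunP e; apply/rowP => i.
  by have := e i; rewrite !ffunE mxE.
apply; apply/ffunP => i; rewrite !ffunE.
have /rowP /(_ i) := vA; rewrite !mxE => vAi; apply: etrans vAi.
by apply: eq_bigr => j _; rewrite !mxE ffunE mulrC.
Qed.

Lemma mx_norm2_perturb A B :
  mx_norm2 A <= mx_norm2 B + \sum_i \sum_j modulus (A i j - B i j).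
Proof.
apply: op_norm_le.
  rewrite addr_ge0 ?mx_norm2_ge0 //.
  by apply: sumr_ge0 => i _; apply: sumr_ge0 => j _; exact: modulus_ge0.
move=> v; rewrite -/(mulop A) -[A in mulop A](subrK B) addrC mulopD mulrDl.
apply: le_trans (form_normD _ _ _) _; apply: lerD; first exact: le_mx_norm2.
apply: le_trans (le_mx_norm2 _ _) _; rewrite ler_wpM2r ?form_norm_ge0 //.
apply: le_trans (mx_norm2_le _) _.
by apply: ler_sum => i _; apply: ler_sum => j _; rewrite !mxE.
Qed.

End ComplexMatrixAction.

(** * Moebius transforms of vectors *)

Section Mobius.
Context {R : realType} {V : lmodType (Cplx R)} (dot : {dot V for @Num.conj (Cplx R)}).
Local Notation N := (form_norm dot).
Implicit Types x y : V.

(** With the roles of [x] and [y] exchanged, this expands both sides of the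
Moebius inequality. *)
Lemma form_normB2 (r : R) x y :
  N (y - toC r *: x) ^+ 2 =
  N y ^+ 2 + r ^+ 2 * N x ^+ 2 - 2 * r * complex.Re (dot y x).
Proof.
rewrite -scaleNr -toCN form_normD2 Re_dotZr form_normZ modulus_toC normrN.
rewrite exprMn -normrX ger0_norm ?sqr_ge0 //; ring.
Qed.

(** The difference of the squares is [(1 - r^2)(|x|^2 - |y|^2)].  With [y = Bx]
it says that [(B - r)(1 - rB)^-1] is a contraction when [B] is one. *)
Lemma mobius_le r x y : 0 <= r <= 1 -> N y <= N x ->
  N (y - toC r *: x) <= N (x - toC r *: y).
Proof.
move=> /andP[r0 r1] yx; rewrite -(@ler_pXn2r _ 2) ?nnegrE ?form_norm_ge0 //.
rewrite !form_normB2 (dotC dot x y) Re_conj.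
have : N y ^+ 2 <= N x ^+ 2 by rewrite ler_pXn2r ?nnegrE ?form_norm_ge0.
have : r ^+ 2 <= 1 by rewrite expr_le1.
nra.
Qed.

Lemma mobius_lower r x y : 0 <= r -> N y <= N x ->
  (1 - r) * N x <= N (x - toC r *: y).
Proof.
move=> r0 yx; rewrite mulrBl mul1r lerBlDr.
rewrite -{1}[x](subrK (toC r *: y)); apply: le_trans (form_normD _ _ _) _.
by rewrite lerD2l form_normZ modulus_toC ger0_norm // ler_wpM2l.
Qed.

(** The choice [r = 1/c] makes the coefficient [c^2 r^2] of [|y|^2] on the right
equal to its coefficient 1 on the left, so that [|y|] drops out. *)
Lemma mobius_numerical_range_le (c t : R) x y : 1 < c -> N x = 1 -> dot y x = toC t ->
  N (y - toC c^-1 *: x) <= c * N (x - toC c^-1 *: y) ->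
  t <= 2^-1 * (c + c^-1).
Proof.
move=> c1 x1 yx.
have c0 : 0 < c by rewrite (lt_trans _ c1).
rewrite -(@ler_pXn2r _ 2) ?nnegrE ?mulr_ge0 ?form_norm_ge0 ?(ltW c0) //.
rewrite exprMn !form_normB2 (dotC dot x y) Re_conj yx x1 /=.
have e : c * c^-1 = 1 by rewrite mulfV // gt_eqF.
have r1 : c^-1 < 1 by rewrite invf_lt1.
move: e r1; set r := c^-1; set s := N y => e r1 h.
have : 2 * t * (c - r) <= (c + r) * (c - r).
  have -> : (c + r) * (c - r) = c ^+ 2 - r ^+ 2 by ring.
  move: h; have -> : c ^+ 2 * (1 ^+ 2 + r ^+ 2 * s ^+ 2 - 2 * r * t) =
     c ^+ 2 + (c * r) ^+ 2 * s ^+ 2 - 2 * c * (c * r) * t by ring.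
  rewrite e; nra.
rewrite ler_pM2r; last by rewrite subr_gt0 (lt_trans r1 c1).
lra.
Qed.

End Mobius.

(** * Moebius transforms of rational matrices *)

Section CommonDenominator.
Context {R : realType}.
Local Notation C := (Cplx R).
Variable K : set C.

(** The identity [F = P/q] in cross-multiplied form, in which it can be evaluated
at points of [K] and at [T]. *)
Lemma common_denominator n (F : 'M[{ratio {poly C}}]_n) :
  (forall i j, poles_off K (F i j)) ->
  exists (P : 'M[{poly C}]_n) (q : {poly C}),
    [/\ q != 0, forall z, K z -> q.[z] != 0 &
        forall i j, P i j * (frac (F i j)).2 = (frac (F i j)).1 * q].
Proof.
move=> FK; pose d (ij : 'I_n * 'I_n) := (frac (F ij.1 ij.2)).2.
exists (\matrix_(i, j) ((frac (F i j)).1 * \prod_(kl | kl != (i, j)) d kl)).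
exists (\prod_kl d kl); split.
- by apply/prodf_neq0 => kl _; exact: denom_ratioP.
- by move=> z Kz; rewrite horner_prod; apply/prodf_neq0 => kl _; exact: FK.
- move=> i j; rewrite mxE [in RHS](bigD1 (i, j)) //= /d /=.
  by rewrite -mulrA (mulrC (\prod_(_ | _) _)).
Qed.

End CommonDenominator.

Lemma scale_swap (A : comNzRingType) (V : lmodType A) (a b : A) (v : V) :
  a *: (b *: v) = b *: (a *: v).
Proof. by rewrite !scalerA mulrC. Qed.

Section MobiusTransform.
Context {R : realType}.
Local Notation C := (Cplx R).
Variable K : set C.
Variables (n : nat) (P : 'M[{poly C}]_n) (q : {poly C}) (r : R).
Hypothesis qK : forall z, K z -> q.[z] != 0.
Hypothesis r01 : 0 <= r < 1.
Hypothesis K0 : K !=set0.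

Local Notation rp := ((toC r)%:P : {poly C}).

(** With [F = P/q], the Moebius transform [(F - r)(1 - rF)^-1] is
[(P - rq)(q - rP)^-1], where the inverse is the adjugate over the
determinant.  Hence [mob_num] and [\det mob_den] are polynomial, and the
transform is again a matrix of rational functions. *)
Definition mob_den : 'M[{poly C}]_n := q%:M - rp *: P.
Definition mob_num : 'M[{poly C}]_n := (P - (rp * q)%:M) *m \adj mob_den.
Definition mobius_mx : 'M[{ratio {poly C}}]_n :=
  \matrix_(i, j) Ratio (mob_num i j) (\det mob_den).

Local Notation Nn := (form_norm (dsum_dot (@Cdot R) (n := n))).

Hypothesis P_contr : forall z, K z -> forall v,
  Nn (mulop (map_mx (horner_eval z) P) v) <= modulus q.[z] * Nn v.

Lemma eval_mob_den z : map_mx (horner_eval z) mob_den =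
  (q.[z])%:M - toC r *: map_mx (horner_eval z) P.
Proof.
by rewrite map_mxB map_scalar_mx map_mxZ /= /horner_eval hornerC.
Qed.

(** In terms of [y = F(z) v], this is [q(z) (v - r y)]. *)
Lemma mob_denE z v : K z -> mulop (map_mx (horner_eval z) mob_den) v =
  q.[z] *: (v - toC r *: (q.[z]^-1 *: mulop (map_mx (horner_eval z) P) v)).
Proof.
move=> Kz; rewrite eval_mob_den mulopD mulopN mulopZ mulop_scalar scalerBr.
move: (mulop _ v) => y; congr (_ - _).
by rewrite scale_swap; congr (_ *: _); rewrite scalerA mulfV ?qK // scale1r.
Qed.

Lemma mob_contr z v : K z ->
  Nn (q.[z]^-1 *: mulop (map_mx (horner_eval z) P) v) <= Nn v.
Proof.
move=> Kz; rewrite form_normZ modulusV ler_pdivrMl ?P_contr //.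
by rewrite lt_def modulus_ge0 modulus_eq0 qK.
Qed.

(** [1 - rF(z)] is bounded below by [1 - r > 0], so the transform has its poles
off [K]. *)
Lemma det_mob_den_neq0 z : K z -> (\det mob_den).[z] != 0.
Proof.
move=> Kz; rewrite -[_.[z]]/(horner_eval z _) -det_map_mx.
apply: det_neq0_mulop => v v0; rewrite mob_denE // scaler_eq0 negb_or qK //=.
rewrite -(form_norm_eq0 (dsum_dot (@Cdot R) (n := n))) gt_eqF //.
have /andP[r0 r1] := r01.
apply: lt_le_trans (mobius_lower r0 (mob_contr v Kz)).
rewrite mulr_gt0 ?subr_gt0 // lt_def form_norm_ge0.
by rewrite form_norm_eq0 v0.
Qed.

Lemma det_mob_den_poly_neq0 : \det mob_den != 0.
Proof.
have [z Kz] := K0; apply: contraTneq (det_mob_den_neq0 Kz) => ->.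
by rewrite horner0 eqxx.
Qed.

Lemma mobius_poles_off i j : poles_off K (mobius_mx i j).
Proof.
rewrite mxE; apply: poles_off_Ratio; first exact: det_mob_den_poly_neq0.
exact: det_mob_den_neq0.
Qed.

(** Each vector [v] is a multiple of [B w], for [B = q(z) - rP(z)] and
[w = adj(B) v], and on [B w] the bound is [mobius_le]. *)
Lemma mobius_mx_le1 z : K z ->
  mx_norm2 (map_mx (rat_eval^~ z) mobius_mx) <= 1.
Proof.
move=> Kz; have D0 := det_mob_den_neq0 Kz; have /andP[r0 r1] := r01.
set D := (\det mob_den).[z] in D0 *.
have -> : map_mx (rat_eval^~ z) mobius_mx =
    D^-1 *: map_mx (horner_eval z) mob_num.
  apply/matrixP => i j; rewrite !mxE rat_eval_Ratio ?det_mob_den_poly_neq0 //.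
  by rewrite mulrC.
apply: op_norm_le => // v; rewrite -/(mulop _) mul1r mulopZ form_normZ modulusV.
rewrite ler_pdivrMl; last by rewrite lt_def modulus_ge0 modulus_eq0 D0.
rewrite /mob_num map_mxM mulopM map_mx_adj.
set B := map_mx (horner_eval z) mob_den.
set w := mulop (\adj B) v.
have <- : Nn (mulop B w) = modulus D * Nn v.
  rewrite -mulopM mul_mx_adj mulop_scalar form_normZ.
  by rewrite det_map_mx.
rewrite mob_denE // form_normZ.
set y := q.[z]^-1 *: _.
have -> : mulop (map_mx (horner_eval z) (P - (rp * q)%:M)) w =
    q.[z] *: (y - toC r *: w).
  rewrite map_mxB map_scalar_mx /= /horner_eval hornerM hornerC mulopD mulopN mulop_scalar.
  rewrite scalerBr; congr (_ - _); last by rewrite [RHS]scalerA mulrC.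
  by rewrite /y [RHS]scalerA mulfV ?qK // scale1r.
rewrite form_normZ; apply: ler_wpM2l; first exact: modulus_ge0.
by apply: mobius_le; [rewrite r0 ltW | exact: mob_contr].
Qed.

End MobiusTransform.

Section Forward.
Context {R : realType} {H : completeNormedModType (Cplx R)}.
Local Notation C := (Cplx R).
Variable dot : {dot H for @Num.conj (Cplx R)}.
Hypothesis norm_dot : forall x : H, `|x| ^+ 2 = dot x x.
Variable T : H -> H.
Hypothesis bT : bounded_op T.
Variable K : set C.
Hypothesis sTK : spectrum T `<=` K.
Let linT : linear T := bT.1.

Section Algebra.
Variables (n : nat) (F : 'M[{ratio {poly C}}]_n) (P : 'M[{poly C}]_n).
Variables (q : {poly C}) (r : R) (alpha : C).
Hypothesis FK : forall i j, poles_off K (F i j).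
Hypothesis q0 : q != 0.
Hypothesis qK : forall z, K z -> q.[z] != 0.
Hypothesis PF : forall i j, P i j * (frac (F i j)).2 = (frac (F i j)).1 * q.
Hypothesis D0 : \det (mob_den (alpha%:P *: P) q r) != 0.
Hypothesis DK : forall z, K z -> (\det (mob_den (alpha%:P *: P) q r)).[z] != 0.

Local Notation A := (mx_op (map_mx (rat_op T) F)).
Local Notation pop := (mx_act (n := n) (poly_op T)).
Local Notation G := (mobius_mx (alpha%:P *: P) q r).

Let popM M M' x : pop (M *m M') x = pop M (pop M' x).
Proof.
apply: mx_actM => [a|a b y|a b y].
- exact: poly_op_linear.
- exact: poly_opD.
- exact: poly_opM.
Qed.
Let popD M M' x : pop (M + M') x = pop M x + pop M' x.
Proof. by apply: mx_actD => a b y; exact: poly_opD. Qed.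
Let popB M M' x : pop (M - M') x = pop M x - pop M' x.
Proof. by have := popD (M - M') M' x; rewrite subrK => ->; rewrite addrK. Qed.
Let pop_scalar p x : pop p%:M x = [ffun i => poly_op T p (x i)].
Proof. by apply: mx_act_scalar => a b y; exact: poly_opD. Qed.
Let popZ p M x : pop (p *: M) x = pop p%:M (pop M x).
Proof.
apply: mx_actZ => [a|a b y|a b y].
- exact: poly_op_linear.
- exact: poly_opD.
- exact: poly_opM.
Qed.
Let pop_const a x : pop (a%:P)%:M x = a *: x.
Proof. by rewrite pop_scalar; apply/ffunP => i; rewrite !ffunE poly_opC. Qed.
Let pop_linear M : linear (pop M).
Proof. by apply: mx_act_linear => a; exact: poly_op_linear. Qed.

(** Clearing denominators at [T], in the form [q(T) F(T) = P(T)]: from here on only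
the polynomial calculus is used for [F]. *)
Lemma pop_denom x : pop q%:M (A x) = pop P x.
Proof.
rewrite pop_scalar; apply/ffunP => i; rewrite !ffunE.
have ql := poly_op_linear linT q.
elim/big_rec2: _ => [|j u v _ <-]; first exact: (lin_map0 ql).
rewrite (lin_mapD ql); congr (_ + _); rewrite !mxE.
apply: (denom_op_inj norm_dot bT sTK (FK i j)).
rewrite -[RHS]poly_opM // mulrC PF mulrC poly_opM // poly_op_comp_comm //.
by rewrite (rat_opP norm_dot bT sTK (FK i j)).
Qed.

(** Apply the injective operators [q(T)] and [D(T)], where [D] is the determinant
of [B = q - r alpha P]: both sides become polynomial matrices applied to [x],
and they agree because [adj(B) B = D]. *)
Lemma mobius_mx_op x :
  mx_op (map_mx (rat_op T) G) (x - toC r *: (alpha *: A x)) =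
  alpha *: A x - toC r *: x.
Proof.
set D := \det (mob_den (alpha%:P *: P) q r).
set y := x - _.
have injD p : p != 0 -> (forall z, K z -> p.[z] != 0) -> injective (pop p%:M).
  move=> p0 pK u v; rewrite !pop_scalar => /ffunP e; apply/ffunP => i.
  have [S [_ c1 _]] := invertible_poly_op norm_dot bT sTK p0 pK.
  by have := e i; rewrite !ffunE => /(can_inj c1).
apply: (injD q q0 qK); apply: (injD D D0 DK).
have eG : pop D%:M (mx_op (map_mx (rat_op T) G) y) = pop (mob_num (alpha%:P *: P) q r) y.
  rewrite pop_scalar; apply/ffunP => i; rewrite !ffunE.
  have Dl := poly_op_linear linT D.
  elim/big_rec2: _ => [|j u v _ <-]; first exact: (lin_map0 Dl).
  rewrite (lin_mapD Dl); congr (_ + _); rewrite !mxE.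
  have GK : poles_off K (Ratio (mob_num (alpha%:P *: P) q r i j) D).
    exact: poles_off_Ratio.
  have := rat_opP norm_dot bT sTK GK (y j).
  by rewrite numer_Ratio // denom_Ratio // /mob_num mxE.
have ey : pop q%:M y = pop (mob_den (alpha%:P *: P) q r) x.
  rewrite /y /mob_den (lin_mapB (@pop_linear _)) !(lin_mapZ (@pop_linear _)) pop_denom.
  by rewrite popB popZ pop_const popZ pop_const.
have cm p M u : pop p%:M (pop M u) = pop M (pop p%:M u).
  by rewrite -!popM scalar_mxC.
rewrite [LHS]cm eG cm ey -popM /mob_num -mulmxA mul_adj_mx -/D scalar_mxC popM.
congr (pop D%:M _).
rewrite (lin_mapB (@pop_linear _)) !(lin_mapZ (@pop_linear _)) pop_denom popB popZ pop_const.
by rewrite scalar_mxM popM pop_const.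
Qed.

End Algebra.
End Forward.

(** * From spectral sets to numerical radius sets *)

Section ForwardTheorem.
Context {R : realType} {H : completeNormedModType (Cplx R)}.
Local Notation C := (Cplx R).
Variable dot : {dot H for @Num.conj (Cplx R)}.
Hypothesis norm_dot : forall x : H, `|x| ^+ 2 = dot x x.
Variable T : H -> H.
Hypothesis bT : bounded_op T.
Variable K : set C.
Hypothesis cK : compact K.
Variable c : R.
Hypothesis c1 : 1 <= c.
Hypothesis hS : complete_spectral_set dot c K T.
Let sTK : spectrum T `<=` K := hS.1.
Let c0 : 0 < c := lt_le_trans ltr01 c1.
Local Notation c' := (2^-1 * (c + c^-1)).

Lemma one_le_c' : 1 <= c'.
Proof.
have e : c * c^-1 = 1 by rewrite mulfV // gt_eqF.
have i0 : 0 < c^-1 by rewrite invr_gt0.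
have := sqr_ge0 (c - 1); move: e i0; set r := c^-1; move=> e r0 h.
have : 0 <= (c + r - 2) * c by nra.
rewrite pmulr_lge0 //; lra.
Qed.

Section Rational.
Variable n : nat.
Hypothesis n0 : (0 < n)%N.
Variable F : 'M[{ratio {poly C}}]_n.
Hypothesis FK : forall i j, poles_off K (F i j).
Local Notation N := (form_norm (dsum_dot dot (n := n))).
Local Notation A := (mx_op (map_mx (rat_op T) F)).

(** The Moebius transform is applied to [alpha F], where [alpha] has modulus
[1/M] and turns [<Ax, x>] into a nonnegative real number. *)
Lemma spectral_numerical_range_le (M : R) x : 0 < M ->
  (forall z, K z -> mx_norm2 (map_mx (rat_eval^~ z) F) <= M) ->
  N x = 1 -> modulus (dsum_dot dot (A x) x) <= c' * M.
Proof.
move=> M0 hM x1.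
have bA (M' : R) : 0 <= M' ->
    (forall z, K z -> mx_norm2 (map_mx (rat_eval^~ z) F) <= M') ->
    modulus (dsum_dot dot (A x) x) <= c * M'.
  move=> M'0 h; apply: le_trans (cauchy_schwarz _ _ _) _; rewrite x1 mulr1.
  have := @spectral_mx_op_le _ _ _ norm_dot _ bT _ sTK c n F M' x (ltW c0) hS n0 FK M'0 h.
  by rewrite x1 mulr1.
(* Without a point of K the determinant of the Moebius transform could be the
   zero polynomial; but then every sup norm is 0, and so is F(T). *)
have [K0|/set0P K0] := eqVneq K set0.
  apply: (@le_trans _ _ (c * 0)); last first.
    by rewrite mulr0 !mulr_ge0 ?ltW // addr_gt0 ?invr_gt0.
  by apply: bA => // z; rewrite K0.
(* For c = 1 one would have r = 1, and 1 - r alpha F need not be invertible. *)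
have [c_eq1|c_neq1] := eqVneq c 1.
  apply: le_trans (bA M (ltW M0) hM) _; rewrite ler_pM2r //.
  by apply: le_trans one_le_c'; rewrite c_eq1.
have c_gt1 : 1 < c by rewrite lt_def c_neq1.
have [P [q [q0 qK PF]]] := common_denominator FK.
have [u u1 hu] := exists_phase (dsum_dot dot (A x) x).
pose r := c^-1; pose alpha := toC M^-1 * u.
have r01 : 0 <= r < 1 by rewrite /r invr_ge0 (ltW c0) invf_lt1.
have modalpha : modulus alpha = M^-1.
  by rewrite modulusM u1 mulr1 modulus_toC ger0_norm // invr_ge0 ltW.
have P_contr z : K z -> forall v,
    form_norm (dsum_dot (@Cdot R) (n := n))
      (mulop (map_mx (horner_eval z) (alpha%:P *: P)) v)
    <= modulus q.[z] * form_norm (dsum_dot (@Cdot R) (n := n)) v.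
  move=> Kz v.
  have -> : map_mx (horner_eval z) (alpha%:P *: P) =
      (alpha * q.[z]) *: map_mx (rat_eval^~ z) F.
    apply/matrixP => i j; rewrite !mxE /horner_eval hornerM hornerC -mulrA.
    congr (_ * _); rewrite /rat_eval mulrA.
    have dz := FK i j Kz; apply: (mulIf dz); rewrite divfK //.
    by rewrite -!hornerM PF mulrC.
  rewrite mulopZ form_normZ modulusM modalpha -!mulrA mulrCA.
  apply: ler_wpM2l; first exact: modulus_ge0.
  rewrite ler_pdivrMl //; apply: le_trans (le_mx_norm2 _ _) _.
  by apply: ler_wpM2r; [exact: form_norm_ge0 | exact: hM].
have DK := det_mob_den_neq0 qK r01 P_contr.
have D0 := det_mob_den_poly_neq0 qK r01 K0 P_contr.
have GK := mobius_poles_off qK r01 K0 P_contr.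
have G1 := mobius_mx_le1 qK r01 K0 P_contr.
have hop := mobius_mx_op norm_dot bT sTK FK q0 qK PF D0 DK x.
have hb := @spectral_mx_op_le _ _ _ norm_dot _ bT _ sTK c n _ 1
  (x - toC r *: (alpha *: A x)) (ltW c0) hS n0 GK ler01 G1.
rewrite hop mulr1 in hb.
have e : dsum_dot dot (alpha *: A x) x = toC (M^-1 * modulus (dsum_dot dot (A x) x)).
  by rewrite linearZl_LR /= /alpha toCM -hu mulrA.
have := mobius_numerical_range_le c_gt1 x1 e hb.
by rewrite ler_pdivrMl // mulrC.
Qed.

End Rational.

(** The entries of [F] are approximated within [e], on [K] and at [T]
simultaneously, by rational functions; the bound for the latter then holds for
[F] up to an error proportional to [e]. *)
Lemma spectral_num_radius : complete_num_radius_set dot c' K T.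
Proof.
split=> // n F n0 FK.
have [X hX] := choice (fun ij : 'I_n * 'I_n =>
  RK_calculus_exists norm_dot bT sTK c0 hS (FK ij.1 ij.2)).
exists (\matrix_(i, j) X (i, j)); first by move=> i j; rewrite mxE; exact: (hX (i, j)).
set S := sup_norm K F.
have c'0 : 0 <= c' by rewrite (le_trans ler01) // one_le_c'.
have S0 : 0 <= S by exact: sup_norm_ge0.
apply: num_radius_le; first exact: mulr_ge0.
move=> x x1.
(* m = n^2 bounds the norm of a matrix whose entries have norm at most 1. *)
set m := (\sum_(i < n) \sum_(j < n) 1 : R).
have m0 : 0 <= m by apply: sumr_ge0 => i _; apply: sumr_ge0.
apply: (@ler_mul_eps _ _ (c' * (m + 1) + m)).
  by rewrite addr_ge0 // mulr_ge0 // addr_ge0.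
move=> e e0.
have hr (ij : 'I_n * 'I_n) : exists r, [/\ poles_off K r,
    forall z, K z -> modulus (rat_eval r z - F ij.1 ij.2 z) <= e &
    forall y, form_norm dot (rat_op T r y - X ij y) <= e * form_norm dot y].
  have [bX /(_ e e0) [d d0 hd]] := hX ij.
  have de0 : 0 < Num.min d e by rewrite lt_min d0.
  have [r rK hr] := RK_approx (FK ij.1 ij.2) de0.
  have [hrd hre] : (forall z, K z -> modulus (rat_eval r z - F ij.1 ij.2 z) <= d) /\
     (forall z, K z -> modulus (rat_eval r z - F ij.1 ij.2 z) <= e).
    by split=> z /hr; rewrite le_min => /andP[].
  exists r; split=> // y.
  have b : form_bounded dot (fun x => rat_op T r x - X ij x).
    apply: form_boundedB; first exact: (rat_op_bounded norm_dot bT sTK).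
    exact/(bounded_opP norm_dot).
  apply: le_trans (le_op_norm y b) _; apply: ler_wpM2r; first exact: form_norm_ge0.
  exact: hd.
have [r hr'] := choice hr.
pose G := \matrix_(i < n, j < n) r (i, j).
have GK i j : poles_off K (G i j) by rewrite mxE; case: (hr' (i, j)).
have GM z : K z -> mx_norm2 (map_mx (rat_eval^~ z) G) <= S + (m + 1) * e.
  move=> Kz; apply: le_trans (mx_norm2_perturb _ (map_mx (fun f : C -> C => f z) F)) _.
  have : 0 <= e by rewrite ltW.
  have : \sum_(i < n) \sum_(j < n) modulus ((map_mx (rat_eval^~ z) G) i j -
      (map_mx (fun f : C -> C => f z) F) i j) <= m * e.
    rewrite /m mulr_suml; apply: ler_sum => i _; rewrite mulr_suml.
    apply: ler_sum => j _; rewrite !mxE mul1r.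
    by have [_ h _] := hr' (i, j); exact: h.
  have := le_sup_norm cK FK Kz; rewrite -/S.
  by move=> h1 h2 e00; rewrite mulrDl mul1r addrA -[leLHS]addr0 !lerD.
have M0 : 0 < S + (m + 1) * e by rewrite ltr_wpDl // mulr_gt0 // ltr_wpDl.
have h1 := spectral_numerical_range_le n0 GK M0 GM x1.
set A := mx_op (map_mx (rat_op T) G) in h1.
set B := mx_op _.
have -> : B x = A x + (B x - A x) by rewrite addrC subrK.
rewrite linearDl; apply: le_trans (modulusD _ _) _.
have h2 : form_norm (dsum_dot dot (n := n)) (B x - A x) <= m * e.
  have -> : B x - A x =
      mx_op (\matrix_(i, j) (fun y => X (i, j) y - rat_op T (G i j) y)) x.
    apply/ffunP => i; rewrite !ffunE -sumrB; apply: eq_bigr => j _.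
    by rewrite !mxE.
  have -> : m * e =
      (\sum_(i < n) \sum_(j < n) `|e|) * form_norm (dsum_dot dot (n := n)) x.
    rewrite x1 mulr1 /m mulr_suml; apply: eq_bigr => i _; rewrite mulr_suml.
    by apply: eq_bigr => j _; rewrite mul1r ger0_norm // ltW.
  apply: mx_op_norm_le => i j v; rewrite !mxE -form_normN opprB.
  by have [_ _ h] := hr' (i, j); exact: h.
apply: (@le_trans _ _ (c' * (S + (m + 1) * e) + m * e)).
  apply: lerD => //; apply: le_trans (cauchy_schwarz _ _ _) _.
  by rewrite x1 mulr1.
by lra.
Qed.

End ForwardTheorem.

(** * From numerical radius sets to spectral sets *)

Section BlockVectors.
Context {R : realType} {V : lmodType (Cplx R)} (dot : {dot V for @Num.conj (Cplx R)}).
Variable n : nat.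
Local Notation W := {ffun 'I_n -> V}.
Implicit Types u v : W.

Definition ffun_cat u v : {ffun 'I_(n + n) -> V} :=
  [ffun k : 'I_(n + n) => match fintype.split k with inl i => u i | inr j => v j end].

Lemma ffun_catl u v i : ffun_cat u v (lshift n i) = u i.
Proof. by rewrite ffunE (unsplitK (inl _ i)). Qed.

Lemma ffun_catr u v i : ffun_cat u v (rshift n i) = v i.
Proof. by rewrite ffunE (unsplitK (inr _ i)). Qed.

Lemma ffun_catP (x : {ffun 'I_(n + n) -> V}) :
  x = ffun_cat [ffun i => x (lshift n i)] [ffun i => x (rshift n i)].
Proof.
apply/ffunP => k; case: (split_ordP k) => i ->.
  by rewrite ffun_catl ffunE.
by rewrite ffun_catr ffunE.
Qed.

Lemma dsum_dot_cat u v u' v' :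
  dsum_dot dot (ffun_cat u v) (ffun_cat u' v') = dsum_dot dot u u' + dsum_dot dot v v'.
Proof.
rewrite /dsum_dot big_split_ord /=; congr (_ + _); apply: eq_bigr => i _.
  by rewrite !ffun_catl.
by rewrite !ffun_catr.
Qed.

Lemma norm2_cat u v :
  form_norm (dsum_dot dot (n := n + n)) (ffun_cat u v) ^+ 2 =
  form_norm (dsum_dot dot (n := n)) u ^+ 2 + form_norm (dsum_dot dot (n := n)) v ^+ 2.
Proof. by rewrite -!Re_dotE /= dsum_dot_cat ReD. Qed.

Lemma mx_op_block (A B C D : 'M[V -> V]_n) u v :
  mx_op (block_mx A B C D) (ffun_cat u v) =
  ffun_cat (mx_op A u + mx_op B v) (mx_op C u + mx_op D v).
Proof.
apply/ffunP => k; case: (split_ordP k) => i ->.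
  rewrite ffun_catl !ffunE big_split_ord /=; congr (_ + _); apply: eq_bigr => j _.
    by rewrite ffun_catl block_mxEul.
  by rewrite ffun_catr block_mxEur.
rewrite ffun_catr !ffunE big_split_ord /=; congr (_ + _); apply: eq_bigr => j _.
  by rewrite ffun_catl block_mxEdl.
by rewrite ffun_catr block_mxEdr.
Qed.

(** The scalar matrix [[a, 1 - a^2], [0, a]] has norm 1: the defect of the square
norm at [(|u|, |v|)] is [(1 - a^2)(|u| - a|v|)^2]. *)
Lemma block_contr (a : R) u y v : 0 <= a <= 1 ->
  form_norm (dsum_dot dot (n := n)) y <= form_norm (dsum_dot dot (n := n)) v ->
  form_norm (dsum_dot dot (n := n + n))
    (ffun_cat (toC a *: u + toC (1 - a ^+ 2) *: y) (toC a *: v)) <=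
  form_norm (dsum_dot dot (n := n + n)) (ffun_cat u v).
Proof.
move=> /andP[a0 a1] yv; rewrite -(@ler_pXn2r _ 2) ?nnegrE ?form_norm_ge0 //.
rewrite !norm2_cat; set N := form_norm _ in yv *.
have b0 : 0 <= 1 - a ^+ 2 by rewrite subr_ge0 expr_le1.
have h : N (toC a *: u + toC (1 - a ^+ 2) *: y) <= a * N u + (1 - a ^+ 2) * N v.
  apply: le_trans (form_normD _ _ _) _; rewrite !form_normZ !modulus_toC !ger0_norm //.
  by rewrite lerD2l ler_wpM2l.
have Nu : 0 <= N u by exact: form_norm_ge0.
have Nv : 0 <= N v by exact: form_norm_ge0.
have h2 : N (toC a *: u + toC (1 - a ^+ 2) *: y) ^+ 2 <=
    (a * N u + (1 - a ^+ 2) * N v) ^+ 2.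
  by rewrite ler_pXn2r ?nnegrE ?form_norm_ge0 // addr_ge0 // mulr_ge0.
have -> : N (toC a *: v) = a * N v by rewrite /N form_normZ modulus_toC ger0_norm.
apply: le_trans (lerD h2 (lexx _)) _; rewrite -subr_ge0.
have -> : N u ^+ 2 + N v ^+ 2 - ((a * N u + (1 - a ^+ 2) * N v) ^+ 2 + (a * N v) ^+ 2) =
  (1 - a ^+ 2) * (N u - a * N v) ^+ 2 by ring.
by rewrite mulr_ge0 // sqr_ge0.
Qed.

End BlockVectors.

Section Backward.
Context {R : realType} {H : completeNormedModType (Cplx R)}.
Local Notation C := (Cplx R).
Variable dot : {dot H for @Num.conj (Cplx R)}.
Hypothesis norm_dot : forall x : H, `|x| ^+ 2 = dot x x.
Variable T : H -> H.
Hypothesis bT : bounded_op T.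
Variable K : set C.
Hypothesis cK : compact K.
Variable c : R.
Hypothesis c1 : 1 <= c.
Local Notation c' := (2^-1 * (c + c^-1)).
Hypothesis hW : complete_num_radius_set dot c' K T.
Let sTK : spectrum T `<=` K := hW.1.
Let linT : linear T := bT.1.
Let c0 : 0 < c := lt_le_trans ltr01 c1.

Definition ratio_cst (a : C) : {ratio {poly C}} := Ratio a%:P 1.
Definition ratio_scale (a : C) (r : {ratio {poly C}}) :=
  Ratio (a *: (frac r).1) (frac r).2.

Lemma poles_off_cst a : poles_off K (ratio_cst a).
Proof.
by apply: poles_off_Ratio; rewrite ?oner_neq0 // => z _; rewrite hornerC oner_neq0.
Qed.

Lemma rat_eval_cst a z : rat_eval (ratio_cst a) z = a.
Proof. by rewrite rat_eval_Ratio ?oner_neq0 // !hornerC divr1. Qed.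

Lemma rat_op_cst a x : rat_op T (ratio_cst a) x = a *: x.
Proof.
apply: (rat_op_eq norm_dot bT sTK); first exact: poles_off_cst.
have n0 := oner_neq0 {poly C}.
by rewrite (denom_Ratio _ n0) (numer_Ratio _ n0) poly_opC -polyC1 poly_opC scale1r.
Qed.

Lemma poles_off_scale a r : poles_off K r -> poles_off K (ratio_scale a r).
Proof. by move=> rK; apply: poles_off_Ratio => //; exact: denom_ratioP. Qed.

Lemma rat_eval_scale a r z : rat_eval (ratio_scale a r) z = a * rat_eval r z.
Proof. by rewrite rat_eval_Ratio ?denom_ratioP // hornerZ mulrA. Qed.

Lemma rat_op_scale a r x : poles_off K r -> rat_op T (ratio_scale a r) x = a *: rat_op T r x.
Proof.
move=> rK; apply: (rat_op_eq norm_dot bT sTK); first exact: poles_off_scale.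
rewrite !numden_Ratio ?denom_ratioP // poly_opZ -(rat_opP norm_dot bT sTK rK).
exact: (lin_mapZ (poly_op_linear linT _)).
Qed.

(** The operators which the hypothesis provides for the entries of [G] are their
rational calculus, by [RK_calculus_rat]. *)
Lemma numerical_range_rat_le n (G : 'M[{ratio {poly C}}]_n) (M : R) x :
  (0 < n)%N -> (forall i j, poles_off K (G i j)) -> 0 <= M ->
  (forall z, K z -> mx_norm2 (map_mx (rat_eval^~ z) G) <= M) ->
  modulus (dsum_dot dot (mx_op (map_mx (rat_op T) G) x) x) <=
    c' * M * form_norm (dsum_dot dot (n := n)) x ^+ 2.
Proof.
move=> n0 GK M0 hM.
have FK i j : RK K ((map_mx (@rat_eval R) G) i j) by rewrite mxE; exact: RK_rat_eval.
have [X hX hw] := hW.2 n _ n0 FK.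
have -> : map_mx (rat_op T) G = X.
  apply/matrixP => i j; have := hX i j; rewrite !mxE => h.
  by rewrite (RK_calculus_rat norm_dot bT sTK (GK i j) h).
have bX : form_bounded (dsum_dot dot (n := n)) (mx_op X).
  by apply: mx_op_bounded => i j; apply/(bounded_opP norm_dot); case: (hX i j).
apply: le_trans (le_num_radius_scaled x bX) _.
apply: ler_wpM2r; first exact: sqr_ge0.
apply: le_trans hw _; apply: ler_wpM2l.
  by rewrite mulr_ge0 // addr_ge0 // ?invr_ge0; exact: ltW c0.
by apply: sup_norm_le => // z Kz; rewrite map_mx_rat_eval; exact: hM.
Qed.

Section Fixed.
Variable n : nat.
Hypothesis n0 : (0 < n)%N.
Variable F : 'M[{ratio {poly C}}]_n.
Hypothesis FK : forall i j, poles_off K (F i j).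
Local Notation N := (form_norm (dsum_dot dot (n := n))).
Local Notation A := (mx_op (map_mx (rat_op T) F)).

Definition block_ratio (a b : C) : 'M[{ratio {poly C}}]_(n + n) :=
  block_mx (map_mx ratio_cst a%:M) (map_mx (ratio_scale b) F)
           (map_mx ratio_cst 0) (map_mx ratio_cst a%:M).

Lemma block_ratio_poles a b i j : poles_off K (block_ratio a b i j).
Proof.
rewrite mxE; case: (fintype.split i) => k; rewrite mxE;
  case: (fintype.split j) => l; rewrite mxE.
- exact: poles_off_cst.
- exact: poles_off_scale.
- exact: poles_off_cst.
- exact: poles_off_cst.
Qed.

Lemma block_ratio_eval a b z : map_mx (rat_eval^~ z) (block_ratio a b) =
  block_mx a%:M (b *: map_mx (rat_eval^~ z) F) 0 a%:M.
Proof.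
rewrite map_block_mx; congr block_mx; apply/matrixP => i j;
  by rewrite !mxE ?rat_eval_cst ?rat_eval_scale.
Qed.

Lemma block_ratio_op a b u v :
  mx_op (map_mx (rat_op T) (block_ratio a b)) (ffun_cat u v) =
  ffun_cat (a *: u + b *: A v) (a *: v).
Proof.
rewrite map_block_mx mx_op_block.
have cst (x : {ffun 'I_n -> H}) :
    mx_op (map_mx (rat_op T) (map_mx ratio_cst a%:M)) x = a *: x.
  apply/ffunP => i; rewrite !ffunE (bigD1 i) //= !mxE eqxx mulr1n rat_op_cst big1 ?addr0 //.
  by move=> j ij; rewrite !mxE eq_sym (negbTE ij) mulr0n rat_op_cst scale0r.
have zero (x : {ffun 'I_n -> H}) :
    mx_op (map_mx (rat_op T) (map_mx ratio_cst 0)) x = 0.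
  apply/ffunP => i; rewrite !ffunE big1 // => j _.
  by rewrite !mxE rat_op_cst scale0r.
have scl x : mx_op (map_mx (rat_op T) (map_mx (ratio_scale b) F)) x = b *: A x.
  apply/ffunP => i; rewrite !ffunE scaler_sumr; apply: eq_bigr => j _.
  by rewrite !mxE rat_op_scale.
by rewrite !cst zero scl add0r.
Qed.

(** If [y = |Av|/M] exceeds [c], the block matrix with diagonal [a = 1/y],
tested at [(Av/|Av|, v)], yields [y + 1/y <= c + 1/c], although [1 <= c < y]. *)
Lemma num_radius_unit_le (M : R) v : 0 < M ->
  (forall z, K z -> mx_norm2 (map_mx (rat_eval^~ z) F) <= M) ->
  N v = 1 -> N (A v) <= c * M.
Proof.
move=> M0 hM v1; rewrite -ler_pdivrMr //; set y := N (A v) / M.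
rewrite leNgt; apply/negP => cy.
have y0 : 0 < y by exact: lt_trans cy.
have y1 : 1 < y by exact: le_lt_trans cy.
have NA : N (A v) = y * M by rewrite /y divfK // gt_eqF.
have NA0 : 0 < N (A v) by rewrite NA mulr_gt0.
pose a := y^-1; pose b := (1 - a ^+ 2) / M.
have a0 : 0 < a by rewrite invr_gt0.
have a1 : a < 1 by rewrite invf_lt1.
have a01 : 0 <= a <= 1 by rewrite !ltW.
have nn0 : (0 < n + n)%N by rewrite addn_gt0 n0.
have G1 z : K z -> mx_norm2 (map_mx (rat_eval^~ z) (block_ratio (toC a) (toC b))) <= 1.
  move=> Kz; rewrite block_ratio_eval; apply: op_norm_le => // x.
  rewrite mul1r -/(mulop _) [x]ffun_catP; move: (finfun _) (finfun _) => w u.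
  rewrite /mulop map_block_mx mx_op_block -!/(mulop _) !mulop_scalar mulopZ.
  have -> : mulop (0 : 'M[C]_n) u = 0.
    by apply/ffunP => i; rewrite !ffunE big1 // => j _; rewrite !mxE mul0r.
  rewrite add0r /b toCM -scalerA; apply: block_contr => //.
  rewrite form_normZ modulus_toC ger0_norm ?invr_ge0 ?(ltW M0) // ler_pdivrMl //.
  apply: le_trans (le_mx_norm2 _ _) _.
  by apply: ler_wpM2r; [exact: form_norm_ge0 | exact: hM].
have := numerical_range_rat_le (ffun_cat (toC (N (A v))^-1 *: A v) v) nn0
  (block_ratio_poles _ _) ler01 G1.
rewrite block_ratio_op norm2_cat dsum_dot_cat.
rewrite form_norm_unit -?(form_norm_eq0 (dsum_dot dot (n := n))) ?gt_eqF //.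
rewrite v1 expr1n mulr1.
have eAA : dsum_dot dot (A v) (A v) = toC (N (A v) ^+ 2) by exact: dotE.
have evv : dsum_dot dot v v = toC (1 ^+ 2) by rewrite -v1; exact: dotE.
have -> : dsum_dot dot (toC a *: (toC (N (A v))^-1 *: A v) + toC b *: A v)
     (toC (N (A v))^-1 *: A v) + dsum_dot dot (toC a *: v) v =
   toC (2 * a + b * N (A v)).
  move: (b) => d; rewrite linearDl !linearZl_LR !linearZr_LR /= !conj_toC eAA evv.
  move: (N (A v)) NA0 => s s0.
  rewrite -!toCM -!toCD; congr toC; field.
  by rewrite gt_eqF.
rewrite modulus_toC => h; have := le_trans (ler_norm _) h.
have -> : b * N (A v) = y - a.
  rewrite NA /b /a; move: (y) y0 => w w0.
  by field; rewrite !gt_eqF.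
have e1 : c * c^-1 = 1 by rewrite mulfV // gt_eqF.
have e2 : y * a = 1 by rewrite /a mulfV // gt_eqF.
have i1 : c^-1 <= 1 by rewrite invf_le1.
have i0 : 0 < c^-1 by rewrite invr_gt0.
move: e1 i1 i0; set r := c^-1 => e1 i1 i0 hh.
(* y + a <= c + r, multiplied out with y a = c r = 1 *)
have : (y - c) * (1 - a * r) <= 0.
  have -> : (y - c) * (1 - a * r) = y + (c * r) * a - c - (y * a) * r by ring.
  rewrite e1 e2; lra.
rewrite pmulr_rle0 ?subr_gt0 //; nra.
Qed.

End Fixed.

Lemma num_radius_spectral : complete_spectral_set dot c K T.
Proof.
split=> // n F n0 FK; set S := sup_norm _ _.
have FK' i j : RK K ((map_mx (@rat_eval R) F) i j) by rewrite mxE; exact: RK_rat_eval.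
have S0 : 0 <= S by exact: sup_norm_ge0.
have hM z : K z -> mx_norm2 (map_mx (rat_eval^~ z) F) <= S.
  by move=> Kz; have := le_sup_norm cK FK' Kz; rewrite map_mx_rat_eval.
have lA : linear (mx_op (map_mx (rat_op T) F)).
  apply: mx_op_linear => i j; rewrite mxE.
  exact: (rat_op_bounded norm_dot bT sTK (FK i j)).1.
apply: op_norm_le; first by rewrite mulr_ge0 // ltW.
move=> x; have [->|x0] := eqVneq x 0; first by rewrite (lin_map0 lA) form_norm0 mulr0.
have Nx : 0 < form_norm (dsum_dot dot (n := n)) x.
  by rewrite lt_def form_norm_eq0 x0 form_norm_ge0.
rewrite -ler_pdivrMr // [leLHS]mulrC.
have -> : (form_norm (dsum_dot dot (n := n)) x)^-1 *
    form_norm (dsum_dot dot (n := n)) (mx_op (map_mx (rat_op T) F) x) =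
    form_norm (dsum_dot dot (n := n)) (mx_op (map_mx (rat_op T) F)
      (toC (form_norm (dsum_dot dot (n := n)) x)^-1 *: x)).
  by rewrite (lin_mapZ lA) form_normZ modulus_toC ger0_norm // invr_ge0 ltW.
apply: (@ler_mul_eps _ _ c); first exact: ltW.
move=> e e0; have -> : c * S + e * c = c * (S + e) by ring.
apply: num_radius_unit_le => //.
- by rewrite ltr_wpDl.
- by move=> z /hM h; rewrite (le_trans h) // lerDl ltW.
- exact: form_norm_unit.
Qed.

End Backward.

Theorem theorem3p1 (R : realType) (c : R) (hc : 1 <= c)
    (H : completeNormedModType (Cplx R))
    (dot : {dot H for @Num.conj (Cplx R)})
    (norm_dot : forall x : H, `|x| ^+ 2 = dot x x)
    (H_nonzero : exists x : H, x != 0)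
    (T : H -> H) (hT : bounded_op T)
    (K : set (Cplx R)) (hK : compact K) :
  complete_spectral_set dot c K T <->
  complete_num_radius_set dot (2^-1 * (c + c^-1)) K T.
Proof.
by split; [exact: spectral_num_radius | exact: num_radius_spectral].
Qed.
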